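(* Let $U$ be a bounded connected open set with smooth boundary in $\mathbb{C}^n$. Suppose there is a holomorphic map $f\colon U\to U$ such that $f(U)$ is contained in a compact subset of $U$ and such that, for some $z\in U$ and for all $k=1,2,\ldots$, the induced map $f_*\colon\pi_k(U,z)\to\pi_k(U,f(z))$ is an isomorphism. Then $U$ is contractible.
   Context: All notions are standard; $\pi_k$ denotes the $k$-th homotopy group. *)

(* Defs.v *)
From HB Require Import structures.
From mathcomp Require Import all_boot all_order all_algebra generic_quotient.
From mathcomp Require Import ring lra.
From mathcomp Require Import all_classical all_reals all_analysis.
From mathcomp Require Import complex.

Set Implicit Arguments.
Unset Strict Implicit.
Unset Printing Implicit Defensive.

Import Order.TTheory GRing.Theory Num.Theory.
Import numFieldNormedType.Exports.

Local Open Scope classical_set_scope.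
Local Open Scope ring_scope.
Local Open Scope quotient_scope.

Section Continuity.

Lemma within_comp (T U V : topologicalType) (A : set T) (B : set U)
    (f : T -> U) (g : U -> V) :
  {within A, continuous f} -> (forall a, A a -> B (f a)) ->
  {within B, continuous g} -> {within A, continuous (g \o f)}.
Proof.
move=> /subspace_continuousP cf AB /subspace_continuousP cg.
apply/subspace_continuousP => a Aa W gW.
have BW : nbhs (f a) [set u | B u -> W (g u)] := cg _ (AB _ Aa) _ gW.
have AW : nbhs a [set b | A b -> B (f b) -> W (g (f b))] := cf _ Aa _ BW.
by apply: filterS AW => b fb Ab /=; exact: fb Ab (AB _ Ab).
Qed.

Lemma within_eq (T U : topologicalType) (A : set T) (f g : T -> U) :
  (forall a, A a -> f a = g a) ->
  {within A, continuous f} -> {within A, continuous g}.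
Proof.
move=> fg; apply: subspace_eq_continuous => a /set_mem Aa; exact: fg.
Qed.

Lemma continuous_pair (T U V : topologicalType) (f : T -> U) (g : T -> V) :
  continuous f -> continuous g -> continuous (fun a => (f a, g a)).
Proof. by move=> cf cg a; apply: cvg_pair; [exact: cf|exact: cg]. Qed.

Lemma continuous_rV (T : topologicalType) (K : topologicalType) k
    (f : T -> 'rV[K]_k) :
  (forall i, continuous (fun a => f a 0 i)) -> continuous f.
Proof.
move=> cf a W [P nP PW]; rewrite nbhs_simpl /=.
have: \forall b \near a, forall j : 'I_k, P 0 j (f b 0 j).
  by apply: filter_forall => j; apply: cf; exact: nP.
by apply: filterS => b fb; apply: PW => i j; rewrite (ord1 i).
Qed.

Lemma within_if (R : realType) (T U : topologicalType) (D : set T)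
    (c : T -> R) (m : R) (f g : T -> U) :
  closed D -> continuous c ->
  {within D `&` [set a | c a <= m], continuous f} ->
  {within D `&` [set a | m <= c a], continuous g} ->
  (forall a, D a -> c a = m -> f a = g a) ->
  {within D, continuous (fun a => if c a <= m then f a else g a)}.
Proof.
move=> cD cc cf cg fg.
have -> : D = (D `&` [set a | c a <= m]) `|` (D `&` [set a | m <= c a]).
  rewrite -setIUr; apply/seteqP; split=> [a Da|a []//]; split => //=.
  by case/orP: (le_total (c a) m); [left|right].
apply: withinU_continuous.
- by apply: closedI => //; apply: closed_comp (@closed_le R m) => a _; exact: cc.
- by apply: closedI => //; apply: closed_comp (@closed_ge R m) => a _; exact: cc.
- by apply: within_eq cf => a [_ /= ->].
- apply: within_eq cg => a [Da /= ma]; case: ifPn => // am.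
  by rewrite fg //; apply/eqP; rewrite eq_le am ma.
Qed.

End Continuity.

Ltac split_ifs :=
  repeat match goal with
  | |- context [if ?b then _ else _] =>
      lazymatch b with
      | context [if _ then _ else _] => fail
      | _ => let H := fresh in
          case: (boolP b) => H; rewrite -?ltNge in H
      end
  end.

Section Cube.
Context {R : realType}.

Definition unit_cube k : set 'rV[R]_k := [set t | forall i, 0 <= t 0 i <= 1].

Definition cube_boundary k : set 'rV[R]_k :=
  [set t | unit_cube t /\ exists i, t 0 i = 0 \/ t 0 i = 1].

Definition cylinder k : set (R * 'rV[R]_k) :=
  `[0, 1]%classic `*` unit_cube (k := k).

Definition with_first k (t : 'rV[R]_k.+1) (s : R) : 'rV[R]_k.+1 :=
  \row_i if i == 0 then s else t 0 i.

End Cube.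

Section Spheroids.
Context {R : realType} {X : topologicalType}.
Implicit Types (x : X) (k : nat).

(* Maps of pairs (I^k, boundary of I^k) -> (X, x); the values outside the cube
   are irrelevant and are ignored by [homotopic_rel]. *)
Record spheroid x k := Spheroid {
  spheroid_fun :> 'rV[R]_k -> X;
  spheroid_continuous : {within unit_cube (k := k), continuous spheroid_fun};
  spheroid_boundary : forall t, cube_boundary t -> spheroid_fun t = x }.

HB.instance Definition _ x k := gen_eqMixin (spheroid x k).
HB.instance Definition _ x k := gen_choiceMixin (spheroid x k).

Definition homotopic_rel x k (g h : spheroid x k) : Prop :=
  exists H : R * 'rV[R]_k -> X,
    [/\ {within cylinder (k := k), continuous H},
        forall t, unit_cube t -> H (0, t) = g t,
        forall t, unit_cube t -> H (1, t) = h t &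
        forall (s : R) t, 0 <= s <= 1 -> cube_boundary t -> H (s, t) = x].

End Spheroids.
Arguments spheroid R {X} x k.
Arguments spheroid_continuous {R X x k} s.
Arguments spheroid_boundary {R X x k} s t.

Section CubeTheory.
Context {R : realType}.

Lemma closed_cube k : closed (unit_cube (R := R) (k := k)).
Proof.
have -> : unit_cube (R := R) (k := k) =
    \bigcap_(i in [set: 'I_k]) [set t : 'rV[R]_k | (0 <= t 0 i <= 1)].
  by apply/seteqP; split => t /= h i; [move=> _; exact: h|exact: h].
apply: closed_bigI => i _.
have -> : [set t : 'rV[R]_k | 0 <= t 0 i <= 1] =
   (fun t : 'rV[R]_k => t 0 i) @^-1` `[0, 1]%classic.
  by apply/seteqP; split => t /=; rewrite in_itv.
apply: closed_comp; last exact: interval_closed.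
by move=> t _; exact: coord_continuous.
Qed.

Lemma closed_cylinder k :
  closed (cylinder (R := R) (k := k)).
Proof.
have -> : cylinder (R := R) (k := k) =
    (fst @^-1` `[0, 1]%classic) `&` (snd @^-1` unit_cube (k := k)) by [].
apply: closedI.
  by apply: closed_comp; [move=> a _; exact: cvg_fst|exact: interval_closed].
by apply: closed_comp; [move=> a _; exact: cvg_snd|exact: closed_cube].
Qed.

Lemma with_firstE k (t : 'rV[R]_k.+1) s : with_first t s 0 0 = s.
Proof. by rewrite mxE eqxx. Qed.

Lemma with_first_id k (t : 'rV[R]_k.+1) : with_first t (t 0 0) = t.
Proof. by apply/rowP => i; rewrite mxE; case: eqP => // ->. Qed.

Lemma with_firstK k (t : 'rV[R]_k.+1) s s' :
  with_first (with_first t s) s' = with_first t s'.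
Proof. by apply/rowP => i; rewrite !mxE; case: eqP. Qed.

Lemma cube_with_first k (t : 'rV[R]_k.+1) s :
  unit_cube t -> 0 <= s <= 1 -> unit_cube (with_first t s).
Proof. by move=> ht hs i; rewrite mxE; case: ifP. Qed.

Lemma boundary_with_first k (t : 'rV[R]_k.+1) s :
  cube_boundary t -> 0 <= s <= 1 ->
  (t 0 0 = 0 -> s = 0 \/ s = 1) -> (t 0 0 = 1 -> s = 0 \/ s = 1) ->
  cube_boundary (with_first t s).
Proof.
move=> [ct [i hi]] hs h0 h1; split; first exact: cube_with_first.
have [i0|ni0] := eqVneq i 0.
  exists 0; rewrite with_firstE; move: hi; rewrite i0.
  by case=> ?; [exact: h0|exact: h1].
by exists i; rewrite mxE (negbTE ni0).
Qed.

Lemma boundary_first k (t : 'rV[R]_k.+1) s :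
  unit_cube t -> s = 0 \/ s = 1 -> cube_boundary (with_first t s).
Proof.
move=> ct hs; split; last by exists 0; rewrite with_firstE.
by apply: cube_with_first => //; case: hs => ->; rewrite ?lexx ler01.
Qed.

Lemma continuous_with_first (T : topologicalType) k (f : T -> 'rV[R]_k.+1)
    (c : T -> R) :
  continuous f -> continuous c -> continuous (fun a => with_first (f a) (c a)).
Proof.
move=> cf cc; apply: continuous_rV => i.
have [i0|ni0] := eqVneq i 0.
  by under eq_fun do rewrite mxE i0 eqxx.
under eq_fun do rewrite mxE (negbTE ni0).
move=> a; apply: (@continuous_comp _ _ _ f (fun t : 'rV[R]_k.+1 => t 0 i)).
  exact: cf.
exact: coord_continuous.
Qed.

Lemma continuous_first k : continuous (fun t : 'rV[R]_k.+1 => t 0 0).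
Proof. exact: coord_continuous. Qed.

Lemma continuous_aff (T : topologicalType) (c : T -> R) (a b : R) :
  continuous c -> continuous (fun t => a * c t + b).
Proof.
move=> cc t; apply: cvgD; last exact: cvg_cst.
by apply: cvgM; [exact: cvg_cst|exact: cc].
Qed.

End CubeTheory.

Section HomotopyEquivalence.
Context {R : realType} {X : topologicalType} (x : X) (k : nat).
Implicit Types g h l : spheroid R x k.

Lemma homotopic_rel_eq g h :
  (forall t, unit_cube t -> g t = h t) -> homotopic_rel g h.
Proof.
move=> gh; exists (fun st => g st.2); split => //=.
- apply: (@within_comp _ _ _ _ (unit_cube (k := k)) snd g).
  + by apply: continuous_subspaceT => a; exact: cvg_snd.
  + by move=> [s t] [].
  + exact: spheroid_continuous.
- by move=> s t _ bt; exact: spheroid_boundary.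
Qed.

Lemma homotopic_rel_refl g : homotopic_rel g g.
Proof. exact: homotopic_rel_eq. Qed.

Lemma homotopic_rel_sym g h : homotopic_rel g h -> homotopic_rel h g.
Proof.
move=> [H [cH H0 H1 Hb]]; exists (H \o (fun st => (1 - st.1, st.2))).
split.
- apply: within_comp cH.
    apply/continuous_subspaceT/continuous_pair => a; last exact: cvg_snd.
    by apply: cvgB; [exact: cvg_cst|exact: cvg_fst].
  move=> [s t] [/= hs ct]; split => //=.
  by move: hs; rewrite !in_itv /=; lra.
- by move=> t ct /=; rewrite subr0 H1.
- by move=> t ct /=; rewrite subrr H0.
- by move=> s t hs bt /=; apply: Hb => //; lra.
Qed.

Lemma homotopic_rel_trans h g l :
  homotopic_rel g h -> homotopic_rel h l -> homotopic_rel g l.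
Proof.
move=> [H [cH H0 H1 Hb]] [K [cK K0 K1 Kb]].
exists (fun st => if st.1 <= 2^-1 then (H \o (fun st => (2 * st.1 + 0, st.2))) st
                  else (K \o (fun st => (2 * st.1 + -1, st.2))) st).
have cS b : continuous (fun st : R * 'rV[R]_k => (2 * st.1 + b, st.2)).
  apply: continuous_pair; last by move=> a; exact: cvg_snd.
  by apply: continuous_aff => ?; exact: cvg_fst.
split => //=.
- apply: (within_if (D := cylinder (k := k)) (c := fst)).
  + exact: closed_cylinder.
  + by move=> a; exact: cvg_fst.
  + apply: within_comp cH; first exact: continuous_subspaceT.
    move=> [s t] [[/= hs ct] s2]; split => //=.
    by move: hs s2; rewrite !in_itv /=; lra.
  + apply: within_comp cK; first exact: continuous_subspaceT.
    move=> [s t] [[/= hs ct] s2]; split => //=.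
    by move: hs s2; rewrite !in_itv /=; lra.
  + move=> [s t] [_ /= ct] ->.
    have -> : 2 * 2^-1 + 0 = 1 :> R by lra.
    have -> : 2 * 2^-1 + -1 = 0 :> R by lra.
    by rewrite H1 // K0.
- move=> t ct; rewrite ifT; last by lra.
  by rewrite mulr0 addr0 H0.
- move=> t ct; rewrite ifF; last by apply/negbTE; rewrite -ltNge; lra.
  have -> : 2 * 1 + -1 = 1 :> R by lra.
  exact: K1.
- move=> s t hs bt; case: leP => h2; [apply: Hb => //; lra|apply: Kb => //; lra].
Qed.

Definition homotopic_relb g h := `[< homotopic_rel g h >].

Lemma homotopic_relb_refl : reflexive homotopic_relb.
Proof. by move=> g; apply/asboolP; exact: homotopic_rel_refl. Qed.

Lemma homotopic_relb_sym : symmetric homotopic_relb.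
Proof.
by move=> g h; apply/idP/idP => /asboolP gh; apply/asboolP;
  exact: homotopic_rel_sym.
Qed.

Lemma homotopic_relb_trans : transitive homotopic_relb.
Proof.
move=> h g l /asboolP gh /asboolP hl; apply/asboolP.
exact: homotopic_rel_trans gh hl.
Qed.

Canonical homotopic_rel_equiv :=
  EquivRel homotopic_relb homotopic_relb_refl homotopic_relb_sym
    homotopic_relb_trans.

Definition homotopy_group : Type := {eq_quot homotopic_rel_equiv}.
HB.instance Definition _ := EqQuotient.on homotopy_group.
HB.instance Definition _ := Choice.on homotopy_group.

Definition homotopy_class g : homotopy_group := \pi_homotopy_group g.

Lemma homotopy_classP g h :
  homotopy_class g = homotopy_class h <-> homotopic_rel g h.
Proof.
split.
  by move/eqmodP => /asboolP.
by move=> gh; apply/eqmodP/asboolP.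
Qed.

Lemma homotopy_class_repr (a : homotopy_group) : homotopy_class (repr a) = a.
Proof. exact: reprK. Qed.

Lemma homotopic_repr g : homotopic_rel (repr (homotopy_class g)) g.
Proof. by apply/homotopy_classP; rewrite homotopy_class_repr. Qed.

End HomotopyEquivalence.
Arguments homotopy_group R {X} x k.

Section HomotopyGroup.
Context {R : realType} {X : topologicalType} (x : X) (k : nat).
Implicit Types g h l : spheroid R x k.+1.

Definition concat_fun (g h : 'rV[R]_k.+1 -> X) (t : 'rV[R]_k.+1) : X :=
  if t 0 0 <= 2^-1 then g (with_first t (2 * t 0 0 + 0))
  else h (with_first t (2 * t 0 0 + -1)).

Lemma concat_continuous g h :
  {within unit_cube (k := k.+1), continuous (concat_fun g h)}.
Proof.
have cS b : continuous (fun t : 'rV[R]_k.+1 => with_first t (2 * t 0 0 + b)).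
  apply: continuous_with_first; first by move=> ?; exact: cvg_id.
  by apply: continuous_aff; exact: continuous_first.
apply: (within_if (f := g \o (fun t => with_first t (2 * t 0 0 + 0)))
  (g := h \o (fun t => with_first t (2 * t 0 0 + -1)))).
- exact: closed_cube.
- exact: continuous_first.
- apply: within_comp (spheroid_continuous g); first exact: continuous_subspaceT.
  move=> t [/= ct t2]; apply: cube_with_first => //.
  by have := ct 0; lra.
- apply: within_comp (spheroid_continuous h); first exact: continuous_subspaceT.
  move=> t [/= ct t2]; apply: cube_with_first => //.
  by have := ct 0; lra.
- move=> t ct /= t2.
  by rewrite !spheroid_boundary //; apply: boundary_first => //; [left|right]; lra.
Qed.

Lemma concat_boundary g h t : cube_boundary t -> concat_fun g h t = x.
Proof.
move=> bt; have h01 := bt.1 0; rewrite /concat_fun; case: leP => t2.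
  by apply: (spheroid_boundary g); apply: boundary_with_first => //; lra.
by apply: (spheroid_boundary h); apply: boundary_with_first => //; lra.
Qed.

Definition concat g h : spheroid R x k.+1 :=
  Spheroid (@concat_continuous g h) (@concat_boundary g h).

Lemma const_continuous :
  {within unit_cube (k := k.+1), continuous (fun _ : 'rV[R]_k.+1 => x)}.
Proof. by apply: continuous_subspaceT; exact: cst_continuous. Qed.

Definition const_spheroid : spheroid R x k.+1 :=
  Spheroid const_continuous (fun _ _ => erefl).

Definition reverse_fun (g : 'rV[R]_k.+1 -> X) (t : 'rV[R]_k.+1) : X :=
  g (with_first t (-1 * t 0 0 + 1)).

Lemma reverse_continuous g :
  {within unit_cube (k := k.+1), continuous (reverse_fun g)}.
Proof.
apply: (within_comp _ _ (spheroid_continuous g)).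
  apply/continuous_subspaceT/continuous_with_first; first by move=> ?; exact: cvg_id.
  by apply: continuous_aff; exact: continuous_first.
by move=> t ct; apply: cube_with_first => //; have := ct 0; lra.
Qed.

Lemma reverse_boundary g t : cube_boundary t -> reverse_fun g t = x.
Proof.
move=> bt; have := bt.1 0 => h01.
by apply: (spheroid_boundary g); apply: boundary_with_first => //; lra.
Qed.

Definition reverse g : spheroid R x k.+1 :=
  Spheroid (@reverse_continuous g) (@reverse_boundary g).

Lemma concat_homotopic g g' h h' :
  homotopic_rel g g' -> homotopic_rel h h' ->
  homotopic_rel (concat g h) (concat g' h').
Proof.
move=> [H [cH H0 H1 Hb]] [K [cK K0 K1 Kb]].
pose S b (st : R * 'rV[R]_k.+1) := (st.1, with_first st.2 (2 * st.2 0 0 + b)).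
have c2 : continuous (fun st : R * 'rV[R]_k.+1 => st.2 0 0).
  move=> a; apply: (@continuous_comp _ _ _ snd (fun t : 'rV[R]_k.+1 => t 0 0)).
    exact: cvg_snd.
  exact: continuous_first.
have cS b : continuous (S b).
  apply: continuous_pair; first by move=> a; exact: cvg_fst.
  apply: (@continuous_with_first _ _ _ snd); first by move=> ?; exact: cvg_snd.
  exact: continuous_aff.
exists (fun st : R * 'rV[R]_k.+1 => if st.2 0 0 <= 2^-1 then (H \o S 0) st else (K \o S (-1)) st).
split => /=.
- apply: within_if => //.
  + exact: closed_cylinder.
  + apply: within_comp cH; first exact: continuous_subspaceT.
    move=> [s t] [[/= hs ct] t2]; split => //=; apply: cube_with_first => //.
    by have := ct 0; lra.
  + apply: within_comp cK; first exact: continuous_subspaceT.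
    move=> [s t] [[/= hs ct] t2]; split => //=; apply: cube_with_first => //.
    by have := ct 0; lra.
  + move=> [s t] [/= hs ct] t2; rewrite /S /=.
    rewrite in_itv /= in hs.
    by rewrite Hb ?Kb //; apply: boundary_first => //; [left|right]; lra.
- move=> t ct; rewrite /S /= /concat_fun; have h01 := ct 0.
  by case: leP => t2; [apply: H0|apply: K0]; apply: cube_with_first => //; lra.
- move=> t ct; rewrite /S /= /concat_fun; have h01 := ct 0.
  by case: leP => t2; [apply: H1|apply: K1]; apply: cube_with_first => //; lra.
- move=> s t hs bt; rewrite /S /=; have h01 := bt.1 0.
  by case: leP => t2; [apply: Hb|apply: Kb] => //;
    apply: boundary_with_first => //; lra.
Qed.

Lemma reverse_homotopic g h :
  homotopic_rel g h -> homotopic_rel (reverse g) (reverse h).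
Proof.
move=> [H [cH H0 H1 Hb]].
exists (H \o (fun st : R * 'rV[R]_k.+1 => (st.1, with_first st.2 (-1 * st.2 0 0 + 1)))).
split => /=.
- apply: within_comp cH.
    apply/continuous_subspaceT/continuous_pair; first by move=> a; exact: cvg_fst.
    apply: (@continuous_with_first _ _ _ snd); first by move=> ?; exact: cvg_snd.
    apply: continuous_aff => b.
    apply: (@continuous_comp _ _ _ snd (fun t : 'rV[R]_k.+1 => t 0 0)).
      exact: cvg_snd.
    exact: continuous_first.
  move=> [s t] [/= hs ct]; split => //=; apply: cube_with_first => //.
  by have := ct 0; lra.
- by move=> t ct; apply: H0; apply: cube_with_first => //; have := ct 0; lra.
- by move=> t ct; apply: H1; apply: cube_with_first => //; have := ct 0; lra.
- move=> s t hs bt; apply: Hb => //; have := bt.1 0 => h01.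
  by apply: boundary_with_first => //; lra.
Qed.

(* Reparametrizations of the first coordinate with the same end points are
   homotopic; all the group laws are instances of this. *)
Lemma reparametrize (g g0 g1 : spheroid R x k.+1) (p0 p1 : R -> R) :
  continuous p0 -> continuous p1 ->
  (forall s, 0 <= s <= 1 -> 0 <= p0 s <= 1) ->
  (forall s, 0 <= s <= 1 -> 0 <= p1 s <= 1) ->
  p0 0 = p1 0 -> p0 1 = p1 1 ->
  (p0 0 = 0 \/ p0 0 = 1) -> (p0 1 = 0 \/ p0 1 = 1) ->
  (forall t, unit_cube t -> g0 t = g (with_first t (p0 (t 0 0)))) ->
  (forall t, unit_cube t -> g1 t = g (with_first t (p1 (t 0 0)))) ->
  homotopic_rel g0 g1.
Proof.
move=> c0 c1 i0 i1 e0 e1 b0 b1 E0 E1.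
pose q (st : R * 'rV[R]_k.+1) :=
  (1 - st.1) * p0 (st.2 0 0) + st.1 * p1 (st.2 0 0).
have cf : continuous (fun st : R * 'rV[R]_k.+1 => st.2 0 0).
  move=> a; apply: (@continuous_comp _ _ _ snd (fun t : 'rV[R]_k.+1 => t 0 0)).
    exact: cvg_snd.
  exact: continuous_first.
have cq : continuous q.
  move=> a; apply: cvgD; apply: cvgM.
  - by apply: cvgB; [exact: cvg_cst|exact: cvg_fst].
  - by apply: continuous_comp; [exact: cf|exact: c0].
  - exact: cvg_fst.
  - by apply: continuous_comp; [exact: cf|exact: c1].
have iq s t : 0 <= s <= 1 -> unit_cube t -> 0 <= q (s, t) <= 1.
  by move=> hs ct; have := i0 _ (ct 0); have := i1 _ (ct 0); rewrite /q /=; nra.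
exists (g \o (fun st : R * 'rV[R]_k.+1 => with_first st.2 (q st))); split => /=.
- apply: (within_comp _ _ (spheroid_continuous g)).
    apply/continuous_subspaceT/continuous_with_first => //.
    by move=> ?; exact: cvg_snd.
  move=> [s t] [/=]; rewrite in_itv /= => hs ct.
  by apply: cube_with_first => //; exact: iq.
- by move=> t ct; rewrite E0 // /q /= subr0 mul1r mul0r addr0.
- by move=> t ct; rewrite E1 // /q /= subrr mul0r mul1r add0r.
- move=> s t hs bt; apply: (spheroid_boundary g); apply: boundary_with_first => //.
  + by apply: iq => //; exact: bt.1.
  + by move=> t0; rewrite /q /= t0 -e0 -mulrDl subrK mul1r.
  + by move=> t0; rewrite /q /= t0 -e1 -mulrDl subrK mul1r.
Qed.

Let continuous_affR (a b : R) : continuous (fun s : R => a * s + b).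
Proof. by apply: continuous_aff => s; exact: cvg_id. Qed.

Let continuous_minR (p q : R -> R) :
  continuous p -> continuous q -> continuous (fun s => Num.min (p s) (q s)).
Proof. by move=> cp cq s; apply: continuous_min; [exact: cp|exact: cq]. Qed.

Let continuous_maxR (p q : R -> R) :
  continuous p -> continuous q -> continuous (fun s => Num.max (p s) (q s)).
Proof. by move=> cp cq s; apply: continuous_max; [exact: cp|exact: cq]. Qed.

Lemma concat_assoc g h l :
  homotopic_rel (concat g (concat h l)) (concat (concat g h) l).
Proof.
apply: homotopic_rel_sym.
pose p (s : R) := Num.min (2 * s + 0)
  (Num.min (1 * s + 4^-1) (2^-1 * s + 2^-1)).
apply: (@reparametrize (concat g (concat h l)) _ _ p (fun s => 1 * s + 0)).
- by apply: continuous_minR => //; apply: continuous_minR.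
- exact: continuous_affR.
- by move=> s hs; rewrite /p !minEle; split_ifs; lra.
- by move=> s; lra.
- by rewrite /p !minEle; split_ifs; lra.
- by rewrite /p !minEle; split_ifs; lra.
- by left; rewrite /p !minEle; split_ifs; lra.
- by right; rewrite /p !minEle; split_ifs; lra.
- move=> t ct; have := ct 0; rewrite /= /concat_fun !with_firstE !with_firstK.
  rewrite /p !minEle => h01.
  by split_ifs; try (exfalso; lra);
    congr (_ (with_first _ _)); lra.
- by move=> t ct; rewrite mul1r addr0 with_first_id.
Qed.

Lemma concat_const_l g : homotopic_rel (concat const_spheroid g) g.
Proof.
pose p (s : R) := Num.max (0 * s + 0) (2 * s + -1).
apply: (@reparametrize g _ _ p (fun s => 1 * s + 0)).
- exact: continuous_maxR.
- exact: continuous_affR.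
- by move=> s hs; rewrite /p !maxEle; split_ifs; lra.
- by move=> s; lra.
- by rewrite /p !maxEle; split_ifs; lra.
- by rewrite /p !maxEle; split_ifs; lra.
- by left; rewrite /p !maxEle; split_ifs; lra.
- by right; rewrite /p !maxEle; split_ifs; lra.
- move=> t ct; have := ct 0; rewrite /= /concat_fun /p !maxEle => h01.
  split_ifs; try (exfalso; lra);
    try (by congr (_ (with_first _ _)); lra);
    by rewrite spheroid_boundary //; apply: boundary_first => //; left; lra.
- by move=> t ct; rewrite mul1r addr0 with_first_id.
Qed.

Lemma concat_const_r g : homotopic_rel (concat g const_spheroid) g.
Proof.
pose p (s : R) := Num.min (2 * s + 0) (0 * s + 1).
apply: (@reparametrize g _ _ p (fun s => 1 * s + 0)).
- exact: continuous_minR.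
- exact: continuous_affR.
- by move=> s hs; rewrite /p !minEle; split_ifs; lra.
- by move=> s; lra.
- by rewrite /p !minEle; split_ifs; lra.
- by rewrite /p !minEle; split_ifs; lra.
- by left; rewrite /p !minEle; split_ifs; lra.
- by right; rewrite /p !minEle; split_ifs; lra.
- move=> t ct; have := ct 0; rewrite /= /concat_fun /p !minEle => h01.
  split_ifs; try (exfalso; lra);
    try (by congr (_ (with_first _ _)); lra);
    by rewrite spheroid_boundary //; apply: boundary_first => //; right; lra.
- by move=> t ct; rewrite mul1r addr0 with_first_id.
Qed.

Lemma concat_reverse_l g : homotopic_rel (concat (reverse g) g) const_spheroid.
Proof.
pose p (s : R) := Num.max (-2 * s + 1) (2 * s + -1).
apply: (@reparametrize g _ _ p (fun s => 0 * s + 1)).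
- exact: continuous_maxR.
- exact: continuous_affR.
- by move=> s hs; rewrite /p !maxEle; split_ifs; lra.
- by move=> s; lra.
- by rewrite /p !maxEle; split_ifs; lra.
- by rewrite /p !maxEle; split_ifs; lra.
- by right; rewrite /p !maxEle; split_ifs; lra.
- by right; rewrite /p !maxEle; split_ifs; lra.
- move=> t ct; have := ct 0.
  rewrite /= /concat_fun /reverse_fun !with_firstE !with_firstK /p !maxEle => h01.
  by split_ifs; try (exfalso; lra);
    congr (_ (with_first _ _)); lra.
- move=> t ct; rewrite (spheroid_boundary g) //; apply: boundary_first => //.
  by right; lra.
Qed.

Lemma concat_reverse_r g : homotopic_rel (concat g (reverse g)) const_spheroid.
Proof.
pose p (s : R) := Num.min (2 * s + 0) (-2 * s + 2).
apply: (@reparametrize g _ _ p (fun s => 0 * s + 0)).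
- exact: continuous_minR.
- exact: continuous_affR.
- by move=> s hs; rewrite /p !minEle; split_ifs; lra.
- by move=> s; lra.
- by rewrite /p !minEle; split_ifs; lra.
- by rewrite /p !minEle; split_ifs; lra.
- by left; rewrite /p !minEle; split_ifs; lra.
- by left; rewrite /p !minEle; split_ifs; lra.
- move=> t ct; have := ct 0.
  rewrite /= /concat_fun /reverse_fun !with_firstE !with_firstK /p !minEle => h01.
  by split_ifs; try (exfalso; lra);
    congr (_ (with_first _ _)); lra.
- move=> t ct; rewrite (spheroid_boundary g) //; apply: boundary_first => //.
  by left; lra.
Qed.

Definition pi_mul (a b : homotopy_group R x k.+1) : homotopy_group R x k.+1 :=
  homotopy_class (concat (repr a) (repr b)).

Definition pi_one : homotopy_group R x k.+1 := homotopy_class const_spheroid.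

Definition pi_inv (a : homotopy_group R x k.+1) : homotopy_group R x k.+1 :=
  homotopy_class (reverse (repr a)).

Lemma pi_mulE g h :
  pi_mul (homotopy_class g) (homotopy_class h) = homotopy_class (concat g h).
Proof. by apply/homotopy_classP/concat_homotopic; exact: homotopic_repr. Qed.

Lemma pi_invE g : pi_inv (homotopy_class g) = homotopy_class (reverse g).
Proof. by apply/homotopy_classP/reverse_homotopic; exact: homotopic_repr. Qed.

Lemma pi_mulA : associative pi_mul.
Proof.
move=> a b c; rewrite -(homotopy_class_repr a) -(homotopy_class_repr b).
rewrite -(homotopy_class_repr c) !pi_mulE.
by apply/homotopy_classP; exact: concat_assoc.
Qed.

Lemma pi_mul1 : left_id pi_one pi_mul.
Proof.
move=> a; rewrite -(homotopy_class_repr a) pi_mulE.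
by apply/homotopy_classP; exact: concat_const_l.
Qed.

Lemma pi_mulr1 : right_id pi_one pi_mul.
Proof.
move=> a; rewrite -(homotopy_class_repr a) pi_mulE.
by apply/homotopy_classP; exact: concat_const_r.
Qed.

Lemma pi_mulV : left_inverse pi_one pi_inv pi_mul.
Proof.
move=> a; rewrite -(homotopy_class_repr a) pi_invE pi_mulE.
by apply/homotopy_classP; exact: concat_reverse_l.
Qed.

Lemma pi_mulrV : right_inverse pi_one pi_inv pi_mul.
Proof.
move=> a; rewrite -(homotopy_class_repr a) pi_invE pi_mulE.
by apply/homotopy_classP; exact: concat_reverse_r.
Qed.

HB.instance Definition _ := isGroup.Build (homotopy_group R x k.+1)
  pi_mulA pi_mul1 pi_mulr1 pi_mulV pi_mulrV.

End HomotopyGroup.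

Section InducedMap.
Context {R : realType} {X Y : topologicalType} (f : X -> Y).
Hypothesis cf : continuous f.
Variables (x : X) (k : nat).

Lemma compose_continuous (g : spheroid R x k) :
  {within unit_cube (k := k), continuous (f \o g)}.
Proof.
apply: (within_comp (B := [set: X]) (spheroid_continuous g)) => //.
exact: continuous_subspaceT.
Qed.

Lemma compose_boundary (g : spheroid R x k) t :
  cube_boundary t -> (f \o g) t = f x.
Proof. by move=> bt /=; rewrite spheroid_boundary. Qed.

Definition compose_spheroid (g : spheroid R x k) : spheroid R (f x) k :=
  Spheroid (@compose_continuous g) (@compose_boundary g).

Definition pi_map (a : homotopy_group R x k) : homotopy_group R (f x) k :=
  homotopy_class (compose_spheroid (repr a)).

Lemma pi_mapE g :
  pi_map (homotopy_class g) = homotopy_class (compose_spheroid g).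
Proof.
apply/homotopy_classP; have [H [cH H0 H1 Hb]] := homotopic_repr g.
exists (f \o H); split => /=.
- apply: (within_comp (B := [set: X]) cH) => //.
  exact: continuous_subspaceT.
- by move=> t ct; rewrite H0.
- by move=> t ct; rewrite H1.
- by move=> s t hs bt; rewrite Hb.
Qed.

End InducedMap.
Arguments pi_map R {X Y f} cf x k a.

Lemma pi_map_morph (R : realType) (X Y : topologicalType) (f : X -> Y)
    (cf : continuous f) (x : X) (k : nat) :
  {morph pi_map R cf x k.+1 : a b / (a * b)%g}.
Proof.
move=> a b; rewrite -(homotopy_class_repr a) -(homotopy_class_repr b).
rewrite [X in pi_map _ _ _ _ X]pi_mulE !pi_mapE [RHS]pi_mulE.
by apply/homotopy_classP/homotopic_rel_eq => t _ /=; rewrite /concat_fun; case: ifP.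
Qed.

Definition group_isomorphism (G H : groupType) (h : G -> H) : Prop :=
  {morph h : a b / (a * b)%g} /\ bijective h.

Definition homotopic (R : realType) (X Y : topologicalType) (f g : X -> Y) :=
  exists H : R * X -> Y,
    [/\ {within `[0, 1]%classic `*` [set: X], continuous H},
        forall a, H (0, a) = f a & forall a, H (1, a) = g a].

Definition contractible (R : realType) (X : topologicalType) : Prop :=
  exists x0 : X, homotopic R idfun (fun=> x0 : X).

Section Smooth.
Context {R : realType} {m : nat}.

Fixpoint Ck_on (k : nat) (V : set 'rV[R]_m) (g : 'rV[R]_m -> R) : Prop :=
  match k with
  | 0 => {in V, continuous g}
  | k'.+1 => (forall p, V p -> differentiable g p) /\
      forall i : 'I_m, Ck_on k' V (fun p => 'D_(delta_mx 0 i) g p)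
  end.

Definition smooth_on (V : set 'rV[R]_m) (g : 'rV[R]_m -> R) : Prop :=
  forall k, Ck_on k V g.

(* Near each of its boundary points, W is the negativity set of a smooth
   function with non-vanishing differential. *)
Definition smooth_boundary (W : set 'rV[R]_m) : Prop :=
  forall p, (closure W `\` W°) p ->
    exists (V : set 'rV[R]_m) (rho : 'rV[R]_m -> R),
      [/\ open V, V p, smooth_on V rho,
          exists v, 'd rho p v != 0 &
          W `&` V = [set q | V q /\ rho q < 0]].

End Smooth.

(* Typed as a numFieldType so that the topology and norm of numFieldType are
   found on the complex numbers. *)
Definition Cplx (R : realType) : numFieldType := R[i].

(* C^n = R^(2n): real parts first, then imaginary parts. *)
Definition realify (R : realType) n (z : 'rV[Cplx R]_n) : 'rV[R]_(n + n) :=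
  row_mx (map_mx (@complex.Re R) z) (map_mx (@complex.Im R) z).

Definition holomorphic_on (R : realType) n m (U : set 'rV[Cplx R]_n)
    (f : 'rV[Cplx R]_n -> 'rV[Cplx R]_m) : Prop :=
  forall z, U z -> differentiable f z.

(* [sigLR U V f] is f seen as a map between the subspaces U and V. *)
Lemma holomorphic_continuous (R : realType) n m (U : set 'rV[Cplx R]_n)
    (V : set 'rV[Cplx R]_m) (f : {fun U >-> V}) :
  holomorphic_on U f -> continuous (sigLR f).
Proof.
move=> hf; have cf : {within U, continuous f}.
  by apply: continuous_in_subspaceT => z /set_mem Uz;
    exact: differentiable_continuous (hf z Uz).
apply: continuous_comp_initial.
have -> : set_val \o sigLR f = sigL U f.
  by [].
exact/subspace_sigL_continuousP.
Qed.

(* Main.v *)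
Require Import Defs.
From mathcomp Require Import all_boot all_order all_algebra.
From mathcomp Require Import all_classical all_reals all_analysis.
From mathcomp Require Import complex.
From mathcomp Require Import ring lra zify.

Import numFieldNormedType.Exports.

Local Open Scope classical_set_scope.
Local Open Scope ring_scope.

Set Implicit Arguments.
Unset Strict Implicit.
Unset Printing Implicit Defensive.

Import Order.TTheory GRing.Theory Num.Theory.

(** The map [f] contracts [U] towards a point. Let [u] be the real or imaginary
    part of a coordinate of an iterate of [f], and let [m] and [m + E] bound it
    on [U]. Both [u - m] and [m + E - u] are positive real parts of holomorphic
    functions, so Harnack's inequality on the compact set [K] that contains
    [f(U)] keeps one of them above a fixed fraction of [E] on [K]: the
    oscillation of [u] shrinks by a constant factor at each iteration
    ([coordinate_oscillation]). Hence some iterate maps [U] into a ball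
    contained in [U] ([iterates_shrink]). Harnack's inequality follows from the
    bound [r * |Re g'(0)| <= 2 * Re g(0)] for [Re g >= 0]
    ([positive_Re_gradient]): the trigonometric kernels [2 + 2 cos] and
    [2 - 2 cos] are nonnegative, and means over circles are computed by Cauchy's
    theorem in Goursat's form ([goursat], [circle_mean_const]).

    A sphere in [U] is carried by that iterate into a ball of [U], where it is
    null-homotopic ([small_image_null]). Since [f] is injective on homotopy
    groups, the sphere itself is null-homotopic ([null_of_iter]). Injectivity is
    given at the base point [z] only, so the argument runs with homotopies that
    may move the base point, and a sphere is first dragged to [z] along a path
    ([move_basepoint]). Therefore every map of a sphere to [U] extends to the
    ball ([fills_of_null]).

    Finally, an open subset [W] of a Euclidean space is an increasing union of
    finite complexes of dyadic cubes whose interiors cover it. When the target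
    fills all spheres, a homotopy between two maps defined on [W] is built one
    cell after the other, the prism over a cell being a ball on whose boundary
    sphere the homotopy is already prescribed ([extend_over_cell],
    [homotopy_from_open]). Between the identity of [U] and a constant map this
    is a contraction of [U]. *)

(** * Goursat's lemma on a rectangle *)

Section Goursat.
Context {R : realType}.
Implicit Types (a b c d s t : R) (h : R -> R).

Definition integral_on a b h : R := \int[lebesgue_measure]_(x in `[a, b]) h x.

Let integral_on_integrable a b h : continuous h ->
  lebesgue_measure.-integrable `[a, b] (EFin \o h).
Proof.
move=> ch; apply: continuous_compact_integrable; first exact: segment_compact.
exact: continuous_subspaceT.
Qed.

Lemma integral_on_split a b c h : continuous h -> a <= b -> b <= c ->
  integral_on a c h = integral_on a b h + integral_on b c h.
Proof.
move=> ch ab bc; rewrite /integral_on.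
have := @Rintegral_itvB R h (BLeft a) (BRight c) b (integral_on_integrable a c ch).
rewrite !bnd_simp => /(_ ab bc).
rewrite Rintegral_itv_obnd_cbnd; last first.
  apply: (integrableS _ _ _ (integral_on_integrable b c ch)) => //.
  by apply: subset_itvr; rewrite bnd_simp.
by move=> <-; rewrite addrC subrK.
Qed.

Lemma integral_onB a b h1 h2 : continuous h1 -> continuous h2 ->
  integral_on a b (fun x => h1 x - h2 x) = integral_on a b h1 - integral_on a b h2.
Proof. by move=> c1 c2; rewrite /integral_on RintegralB //; exact: integral_on_integrable. Qed.

Lemma integral_on_cst a b k : a <= b -> integral_on a b (fun=> k) = k * (b - a).
Proof.
move=> ab; rewrite /integral_on Rintegral_cst //; congr (_ * _).
have := @lebesgue_measure_itv R `[a, b]; rewrite /= lte_fin => mE.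
transitivity (fine (if (a < b)%R then b%:E - a%:E else 0%E)%E); first by rewrite -mE.
by case: ltgtP ab => [_ _|//|-> _]; rewrite ?subrr.
Qed.

Lemma le_integral_on a b h1 h2 : continuous h1 -> continuous h2 ->
  (forall x, a <= x <= b -> h1 x <= h2 x) -> integral_on a b h1 <= integral_on a b h2.
Proof.
by move=> c1 c2 h12; apply: le_Rintegral => //; exact: integral_on_integrable.
Qed.

Lemma integral_on_approx a b h k e : continuous h -> a <= b ->
  (forall x, a <= x <= b -> `|h x - k| <= e) ->
  `|integral_on a b h - k * (b - a)| <= e * (b - a).
Proof.
move=> ch ab he; rewrite ler_norml; apply/andP; split.
  rewrite -mulNr lerBrDr -mulrDl -integral_on_cst // le_integral_on //; first exact: cst_continuous.
  by move=> x /he; rewrite ler_norml => /andP[+ _]; lra.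
rewrite lerBlDr -mulrDl -integral_on_cst // le_integral_on //; first exact: cst_continuous.
by move=> x /he; rewrite ler_norml => /andP[_]; lra.
Qed.

(** Otherwise [B] fails on nested quarters that shrink to a point, hence on
    arbitrarily small rectangles around it. The rectangles of the local
    hypothesis contain the point instead of being centred at it, as the
    quarters do. *)
Lemma rect_bisection (B : R -> R -> R -> R -> Prop) a b c d :
  a <= b -> c <= d ->
  (forall a b c d, a <= b -> c <= d ->
     let m := (a + b) / 2 in let n := (c + d) / 2 in
     B a m c n -> B m b c n -> B a m n d -> B m b n d -> B a b c d) ->
  (forall s t, a <= s <= b -> c <= t <= d ->
     exists2 e : R, 0 < e & forall a' b' c' d',
       a <= a' <= s -> s <= b' <= b -> c <= c' <= t -> t <= d' <= d ->
       b' - a' < e -> d' - c' < e -> B a' b' c' d') ->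
  B a b c d.
Proof.
move=> ab cd Bsub Bloc; apply: contrapT => nB.
pose T := {r : R * R * R * R | [/\ a <= r.1.1.1 <= r.1.1.2,  r.1.1.2 <= b,
  c <= r.1.2 <= r.2, r.2 <= d & ~ B r.1.1.1 r.1.1.2 r.1.2 r.2]}.
pose step (x y : T) := let p := sval x in let q := sval y in
  [/\ p.1.1.1 <= q.1.1.1, q.1.1.2 <= p.1.1.2, p.1.2 <= q.1.2, q.2 <= p.2 &
   q.1.1.2 - q.1.1.1 = (p.1.1.2 - p.1.1.1) / 2 /\ q.2 - q.1.2 = (p.2 - p.1.2) / 2].
have next x : {y | step x y}.
  apply: cid; rewrite /step; move: (sval x) (svalP x) => -[[[p q] u] v] /=
    [/andP[ap pq] qb /andP[cu uv] vd nb].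
  apply: contrapT => nex; apply: nb; apply: Bsub => //.
  - apply: contrapT => nb; apply: nex.
    unshelve eexists (exist _ (p, (p + q) / 2, u, (u + v) / 2) _).
      by split=> //=; lra.
    by split => //=; lra.
  - apply: contrapT => nb; apply: nex.
    unshelve eexists (exist _ ((p + q) / 2, q, u, (u + v) / 2) _).
      by split=> //=; lra.
    by split => //=; lra.
  - apply: contrapT => nb; apply: nex.
    unshelve eexists (exist _ (p, (p + q) / 2, (u + v) / 2, v) _).
      by split=> //=; lra.
    by split => //=; lra.
  - apply: contrapT => nb; apply: nex.
    unshelve eexists (exist _ ((p + q) / 2, q, (u + v) / 2, v) _).
      by split=> //=; lra.
    by split => //=; lra.
have hy0 : [/\ a <= a <= b, b <= b, c <= c <= d, d <= d & ~ B a b c d].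
  by rewrite !lexx.
pose y0 : T := exist _ (a, b, c, d) hy0.
have [F [F0 FS]] := dependent_choice next y0.
pose A n := (sval (F n)).1.1.1; pose A' n := (sval (F n)).1.1.2.
pose C n := (sval (F n)).1.2; pose C' n := (sval (F n)).2.
have lim (L L' : nat -> R) : (forall n, L n <= L n.+1) ->
    (forall n, L' n.+1 <= L' n) -> (forall n, L n <= L' n) ->
    exists s, forall n, L n <= s <= L' n.
  move=> Li Li' LL.
  have Lm m n : (m <= n)%N -> L m <= L n.
    by move=> mn; apply: (homo_leq (@lexx _ R) (@le_trans _ R)).
  have Lm' m n : (m <= n)%N -> L' n <= L' m.
    apply: (@homo_leq _ L' (fun x y => y <= x)) => //.
    by move=> y x z xy yz; exact: le_trans yz xy.
  have hub m n : L m <= L' n.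
    case/orP: (leq_total m n) => mn; first exact: le_trans (Lm _ _ mn) (LL _).
    exact: le_trans (LL _) (Lm' _ _ mn).
  exists (sup (range L)) => n; apply/andP; split.
    apply: ub_le_sup; last by exists n.
    by exists (L' 0) => _ [m _ <-].
  apply: ge_sup; first by exists (L 0%N), 0%N.
  by move=> _ [m _ <-].
have [s sA] : exists s, forall n, A n <= s <= A' n.
  apply: lim => n; try by case: (FS n).
  by rewrite /A /A'; case: (svalP (F n)) => /andP[].
have [t tC] : exists s, forall n, C n <= s <= C' n.
  apply: lim => n; try by case: (FS n).
  by rewrite /C /C'; case: (svalP (F n)) => _ _ /andP[].
have szA n : A' n - A n = (b - a) / 2 ^+ n.
  elim: n => [|n IH]; first by rewrite /A /A' F0 /= divr1.
  have [_ _ _ _ [+ _]] := FS n; rewrite -/(A n) -/(A' n) -/(A n.+1) -/(A' n.+1).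
  by move=> ->; rewrite IH exprS invfM (mulrC 2^-1) mulrA.
have szC n : C' n - C n = (d - c) / 2 ^+ n.
  elim: n => [|n IH]; first by rewrite /C /C' F0 /= divr1.
  have [_ _ _ _ [_]] := FS n; rewrite -/(C n) -/(C' n) -/(C n.+1) -/(C' n.+1).
  by move=> ->; rewrite IH exprS invfM (mulrC 2^-1) mulrA.
have in0 n : [/\ a <= A n, A' n <= b, c <= C n & C' n <= d].
  by rewrite /A /A' /C /C'; case: (svalP (F n)) => /andP[? ?] ? /andP[? ?] ? _.
have [e e0 He] : exists2 e : R, 0 < e & forall a' b' c' d',
       a <= a' <= s -> s <= b' <= b -> c <= c' <= t -> t <= d' <= d ->
       b' - a' < e -> d' - c' < e -> B a' b' c' d'.
  apply: Bloc.
    by have := sA 0%N; have [] := in0 0%N; lra.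
  by have := tC 0%N; have [] := in0 0%N; lra.
have small (w : R) : exists N, w / 2 ^+ N < e /\ forall n, (N <= n)%N -> w / 2 ^+ n < e.
  suff [N HN] : exists N, forall n, (N <= n)%N -> w / 2 ^+ n < e.
    by exists N; split => //; exact: HN.
  have := @cvg_geometric R w 2^-1; rewrite ger0_norm ?invr_ge0 // invf_lt1 // ltr1n.
  move=> /(_ isT) /cvgr_lt /(_ _ e0) [N _ HN]; exists N => n Nn.
  by have := HN n Nn; rewrite /= /geometric /= exprVn.
have [N1 [_ H1]] := small (b - a); have [N2 [_ H2]] := small (d - c).
pose N := maxn N1 N2.
have : B (A N) (A' N) (C N) (C' N).
  have [? ? ? ?] := in0 N; have /andP[? ?] := sA N; have /andP[? ?] := tC N.
  apply: He; rewrite ?szA ?szC; [lra|lra|lra|lra| |].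
    by apply: H1; rewrite leq_maxl.
  by apply: H2; rewrite leq_maxr.
by rewrite /A /A' /C /C'; case: (svalP (F N)).
Qed.

(** The defect between the two sides is additive over the four quarters of a
    rectangle, and so is the sum of squares of the side lengths. Around each
    point the linear parts of [P] and [Q] cancel, which bounds the defect by
    [e] times that sum; bisection then gives the bound on the whole rectangle,
    for every [e]. Since the partial derivatives may be discontinuous, the
    proof bisects instead of differentiating under the integral sign. *)
Lemma goursat (P Q : R -> R -> R) a b c d : a <= b -> c <= d ->
  (forall s, continuous (Q s)) -> (forall t, continuous (P^~ t)) ->
  (forall s t, a <= s <= b -> c <= t <= d -> exists k l m : R,
     forall e, 0 < e -> exists2 r : R, 0 < r & forall s' t',
       a <= s' <= b -> c <= t' <= d -> `|s' - s| < r -> `|t' - t| < r ->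
       `|Q s' t' - Q s t - (k * (s' - s) + l * (t' - t))|
          <= e * (`|s' - s| + `|t' - t|) /\
       `|P s' t' - P s t - (m * (s' - s) + k * (t' - t))|
          <= e * (`|s' - s| + `|t' - t|)) ->
  integral_on c d (fun t => Q b t - Q a t) = integral_on a b (fun s => P s d - P s c).
Proof.
move=> ab cd cQ cP hPQ.
pose I a b c d := integral_on c d (fun t => Q b t - Q a t) -
                  integral_on a b (fun s => P s d - P s c).
suff I0 e : 0 < e -> `|I a b c d| <= e * ((b - a) ^+ 2 + (d - c) ^+ 2).
  apply/subr0_eq/normr0_eq0/le_anti; rewrite normr_ge0 andbT -/(I a b c d).
  apply/ler_addgt0Pr => e e0; rewrite add0r.
  set w := (b - a) ^+ 2 + (d - c) ^+ 2.
  have w0 : 0 <= w by rewrite addr_ge0 // sqr_ge0.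
  apply: le_trans (I0 (e / (w + 1)) _) _; first by rewrite divr_gt0 // ltr_wpDl.
  rewrite -/w -mulrA ler_piMr ?(ltW e0) // mulrC ler_pdivrMr ?mul1r; lra.
have cQB s s' : continuous (fun t => Q s' t - Q s t).
  by move=> x; apply: cvgB; exact: cQ.
have cPB t t' : continuous (fun s => P s t' - P s t).
  by move=> x; apply: cvgB; [exact: (cP t')|exact: (cP t)].
move=> e0.
pose B a b c d := `|I a b c d| <= e * ((b - a) ^+ 2 + (d - c) ^+ 2).
apply: (rect_bisection (B := B)) => //.
  move=> {hPQ} {}a {}b {}c {}d {}ab {}cd m n; rewrite /B /I.
  have am : a <= m by rewrite /m; lra.
  have mb : m <= b by rewrite /m; lra.
  have cn : c <= n by rewrite /n; lra.
  have nd : n <= d by rewrite /n; lra.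
  have -> : integral_on c d (fun t => Q b t - Q a t) =
      integral_on c n (fun t => Q m t - Q a t) + integral_on c n (fun t => Q b t - Q m t) +
      integral_on n d (fun t => Q m t - Q a t) + integral_on n d (fun t => Q b t - Q m t).
    by rewrite (integral_on_split (b := n)) // !integral_onB //; lra.
  have -> : integral_on a b (fun s => P s d - P s c) =
      integral_on a m (fun s => P s n - P s c) + integral_on a m (fun s => P s d - P s n) +
      integral_on m b (fun s => P s n - P s c) + integral_on m b (fun s => P s d - P s n).
    have cPt t : continuous (fun s => P s t) by exact: cP.
    by rewrite (integral_on_split (b := m)) // !integral_onB //; lra.
  have -> : b - a = 2 * (m - a) by rewrite /m; lra.
  have -> : d - c = 2 * (n - c) by rewrite /n; lra.
  have -> : b - m = m - a by rewrite /m; lra.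
  have -> : d - n = n - c by rewrite /n; lra.
  by rewrite !ler_norml !exprMn; lra.
move=> s t sab tcd; have [k [l [m H]]] := hPQ s t sab tcd.
have [r r0 {}H] := H (e / 8) ltac:(lra).
exists r => // a' b' c' d' a's b's c't d't bar dcr.
have x0 : 0 <= b' - a' by lra.
have y0 : 0 <= d' - c' by lra.
have HQ t' : c' <= t' <= d' ->
    `|Q b' t' - Q a' t' - k * (b' - a')| <= e / 8 * ((b' - a') + 2 * (d' - c')).
  move=> ht; have tt : `|t' - t| <= d' - c' by rewrite ler_norml; lra.
  have bs : `|b' - s| = b' - s by rewrite ger0_norm //; lra.
  have as_ : `|a' - s| = s - a' by rewrite distrC ger0_norm //; lra.
  have [||||] := H b' t'; [lra|lra|lra|lra|rewrite bs => + _].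
  have [||||] := H a' t'; [lra|lra|lra|lra|rewrite as_ => + _].
  have : e / 8 * `|t' - t| <= e / 8 * (d' - c') by rewrite ler_wpM2l //; lra.
  by rewrite !ler_norml; lra.
have HP s' : a' <= s' <= b' ->
    `|P s' d' - P s' c' - k * (d' - c')| <= e / 8 * (2 * (b' - a') + (d' - c')).
  move=> ht; have tt : `|s' - s| <= b' - a' by rewrite ler_norml; lra.
  have bs : `|d' - t| = d' - t by rewrite ger0_norm //; lra.
  have as_ : `|c' - t| = t - c' by rewrite distrC ger0_norm //; lra.
  have [||||] := H s' d'; [lra|lra|lra|lra|rewrite bs => _].
  have [||||] := H s' c'; [lra|lra|lra|lra|rewrite as_ => _].
  have : e / 8 * `|s' - s| <= e / 8 * (b' - a') by rewrite ler_wpM2l //; lra.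
  by rewrite !ler_norml; lra.
have := integral_on_approx (cQB a' b') (ltac:(lra) : c' <= d') HQ.
have := integral_on_approx (cPB c' d') (ltac:(lra) : a' <= b') HP.
rewrite /B /I; set X := b' - a'; set Y := d' - c'.
have eX : 0 <= e * X ^+ 2 by rewrite mulr_ge0 ?sqr_ge0 // ltW.
have eY : 0 <= e * Y ^+ 2 by rewrite mulr_ge0 ?sqr_ge0 // ltW.
have eXY : 0 <= e * (X - Y) ^+ 2 by rewrite mulr_ge0 ?sqr_ge0 // ltW.
by rewrite !ler_norml; rewrite !expr2 in eX eY eXY *; lra.
Qed.

End Goursat.

(** * Complex modulus and complex derivative *)

Lemma derivable_bound (K : numFieldType) (V W : normedModType K) (f : V -> W)
    (a v : V) (e : K) : derivable f a v -> 0 < e ->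
  exists2 d : K, 0 < d & forall h : K, `|h| < d ->
    `|f (h *: v + a) - f a - h *: 'D_v f a| <= e * `|h|.
Proof.
move=> /derivable_nbhs /eqaddoP /(_ e) H e0.
have [d /= d0 Hd] := H e0; exists d => // h hd.
have /= := Hd h; rewrite /ball_ /= sub0r normrN => /(_ hd).
by rewrite /= !fctE opprD addrA.
Qed.

Section ComplexModulus.
Context {R : realType}.
Implicit Types z w : Cplx R.

Definition cabs z : R := Normc.normc (z : R[i]).

Lemma normcE z : `|z| = (cabs z)%:C%C :> R[i].
Proof. by []. Qed.

Lemma cabsM z w : cabs (z * w) = cabs z * cabs w.
Proof. exact: Normc.normcM. Qed.

Lemma cabsD z w : cabs (z + w) <= cabs z + cabs w.
Proof. exact: (le_normcD (z : Rcomplex R) w). Qed.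

Lemma cabsN z : cabs (- z) = cabs z.
Proof. exact: (normcN (z : Rcomplex R)). Qed.

Lemma cabs0 : cabs 0 = 0.
Proof. exact: Normc.normc0. Qed.

Lemma cabs_ge0 z : 0 <= cabs z.
Proof. by rewrite /cabs; case: z => a b /=; exact: sqrtr_ge0. Qed.

Lemma cabs_eq0 z : (cabs z == 0) = (z == 0).
Proof.
by apply/eqP/eqP => [|->]; [exact: Normc.eq0_normc|exact: cabs0].
Qed.

Lemma cabs_ReIm z : cabs z <= `|complex.Re z| + `|complex.Im z|.
Proof.
case: z => a b /=; rewrite /cabs /=.
rewrite -[leRHS]ger0_norm ?addr_ge0 // -sqrtr_sqr ler_wsqrtr //.
rewrite sqrrD !real_normK ?num_real // -addrA lerD2l lerDr.
by rewrite mulrn_wge0 // mulr_ge0.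
Qed.

Lemma Re_cabs z : `|complex.Re z| <= cabs z.
Proof.
by case: z => a b /=; rewrite /cabs /= -sqrtr_sqr ler_wsqrtr // lerDl sqr_ge0.
Qed.

Lemma Im_cabs z : `|complex.Im z| <= cabs z.
Proof.
by case: z => a b /=; rewrite /cabs /= -sqrtr_sqr ler_wsqrtr // lerDr sqr_ge0.
Qed.

Lemma cabs_real (x : R) : cabs x%:C%C = `|x|.
Proof. by rewrite /cabs /= expr0n /= addr0 sqrtr_sqr. Qed.

Lemma ReD z w : complex.Re (z + w) = complex.Re z + complex.Re w.
Proof. by case: z w => [a b] [c d]. Qed.

Lemma ReB z w : complex.Re (z - w) = complex.Re z - complex.Re w.
Proof. by case: z w => [a b] [c d]. Qed.

Lemma ImD z w : complex.Im (z + w) = complex.Im z + complex.Im w.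
Proof. by case: z w => [a b] [c d]. Qed.

Lemma ImB z w : complex.Im (z - w) = complex.Im z - complex.Im w.
Proof. by case: z w => [a b] [c d]. Qed.

Lemma ReM z w :
  complex.Re (z * w) = complex.Re z * complex.Re w - complex.Im z * complex.Im w.
Proof. by case: z w => [a b] [c d]. Qed.

Lemma ImM z w :
  complex.Im (z * w) = complex.Re z * complex.Im w + complex.Im z * complex.Re w.
Proof. by case: z w => [a b] [c d]. Qed.

Definition expi (t : R) : Cplx R := (cos t +i* sin t)%C.

Lemma cabs_expi t : cabs (expi t) = 1.
Proof. by rewrite /cabs /= cos2Dsin2 sqrtr1. Qed.

(** The radii are real numbers here, so that complex derivatives can be fed into
    real estimates on circles and segments. *)
Definition cdiff (F : Cplx R -> Cplx R) z (D : Cplx R) := forall e : R, 0 < e ->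
  exists2 d : R, 0 < d & forall h, cabs h < d ->
    cabs (F (z + h) - F z - D * h) <= e * cabs h.

Lemma derivable_cdiff (F : Cplx R -> Cplx R) z :
  derivable F z 1 -> cdiff F z ('D_1 F z).
Proof.
move=> dF e e0; have e0C : 0 < (e%:C%C : Cplx R) by rewrite ltcR.
have [d d0 Hd] := derivable_bound dF e0C.
have dE : d = (complex.Re d)%:C%C :> R[i].
  by apply/esym/RRe_real; exact: gtr0_real.
have d0' : 0 < complex.Re d by rewrite -ltcR -dE.
exists (complex.Re d) => // h hd.
have := Hd h; rewrite [d]dE normcE ltcR => /(_ hd).
rewrite -lecR rmorphM /= => H.
apply: le_trans H; rewrite -normcE.
by rewrite scaler1 (addrC h) mulrC.
Qed.

End ComplexModulus.

(** * Means of holomorphic functions over circles *)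

Section CircleMean.
Context {R : realType}.
Implicit Types (z w : Cplx R) (s t r : R).

Definition polar r t : Cplx R := r%:C%C * expi t.

Lemma cabs_polar r t : cabs (polar r t) = `|r|.
Proof. by rewrite cabsM cabs_expi cabs_real mulr1. Qed.

Let real_derivative_bound (f : R -> R) (x df e : R) : is_derive x (1 : R) f df -> 0 < e ->
  exists2 d : R, 0 < d & forall y, `|y - x| < d ->
    `|f y - f x - df * (y - x)| <= e * `|y - x|.
Proof.
move=> [fx <-] e0; have [d d0 H] := derivable_bound fx e0.
exists d => // y /H; have -> : (y - x) *: (1 : R) + x = y.
  by rewrite [_ *: _]mulr1 subrK.
by rewrite (mulrC ('D_1 f x)).
Qed.

Lemma expi_diff t e : 0 < e -> exists2 d : R, 0 < d & forall t', `|t' - t| < d ->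
  cabs (expi t' - expi t - 'i%C * expi t * (t' - t)%:C%C) <= e * `|t' - t|.
Proof.
move=> e0; have e2 : 0 < e / 2 by rewrite divr_gt0.
have [d1 d10 H1] := real_derivative_bound (is_derive_cos t) e2.
have [d2 d20 H2] := real_derivative_bound (is_derive_sin t) e2.
exists (Num.min d1 d2); first by rewrite lt_min d10.
move=> t'; rewrite lt_min => /andP[/H1 {}H1 /H2 {}H2].
apply: le_trans (cabs_ReIm _) _.
rewrite (splitr e) mulrDl; apply: lerD.
  apply: le_trans H1; rewrite le_eqVlt; apply/orP; left; apply/eqP.
  by congr `|_|; rewrite !(ReB, ReM, ImM) /=; ring.
apply: le_trans H2; rewrite le_eqVlt; apply/orP; left; apply/eqP.
by congr `|_|; rewrite !(ImB, ReM, ImM) /=; ring.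
Qed.

(** The radius is written [expR s] because the chart [(s, t)] is conformal:
    the Cauchy-Riemann equations keep the shape that [goursat] asks for,
    without division by the radius. *)
Lemma polar_exp_diff s t e : 0 < e -> exists2 d : R, 0 < d & forall s' t',
  `|s' - s| < d -> `|t' - t| < d ->
  cabs (polar (expR s') t' - polar (expR s) t
        - polar (expR s) t * ((s' - s) +i* (t' - t))%C)
    <= e * (`|s' - s| + `|t' - t|).
Proof.
move=> e0; set x := expR s; have x0 : 0 < x by exact: expR_gt0.
pose n := Num.min 1 (e / (2 * (x + 1))).
have n0 : 0 < n by rewrite lt_min ltr01 divr_gt0 // mulr_gt0 // ltr_wpDr.
have n1 : n <= 1 by rewrite ge_min lexx.
have ne : n * (2 * (x + 1)) <= e.
  by rewrite -ler_pdivlMr ?mulr_gt0 ?ltr_wpDr // ge_min lexx orbT.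
have [d1 d10 H1] := real_derivative_bound (is_derive_expR s) n0.
have [d2 d20 H2] := expi_diff t n0.
exists (Num.min (n / 2) (Num.min d1 d2)); first by rewrite !lt_min d10 d20 divr_gt0.
move=> s' t'; rewrite !lt_min => /and3P[_ /H1 {}H1 _] /and3P[tn _ /H2 {}H2].
rewrite -/x in H1; set X := expR s' in H1 *.
rewrite /polar; set y := expi t in H2 *; set Y := expi t' in H2 *.
have -> : X%:C%C * Y - x%:C%C * y - x%:C%C * y * ((s' - s) +i* (t' - t))%C =
  (X - x - x * (s' - s))%:C%C * y + x%:C%C * (Y - y - 'i%C * y * (t' - t)%:C%C) +
  (X - x)%:C%C * (Y - y) :> Cplx R.
  have -> : (((s' - s) +i* (t' - t))%C : Cplx R) =
      (s' - s)%:C%C + 'i%C * (t' - t)%:C%C.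
    by apply/eqP; rewrite eq_complex !(ReD, ImD, ReM, ImM) /=; apply/andP; split;
      apply/eqP; ring.
  rewrite !rmorphB !rmorphM /= !rmorphB; ring.
set a := `|s' - s| in H1 *; set b := `|t' - t| in H2 tn *.
have Xx : `|X - x| <= (x + n) * a.
  rewrite -(subrK (x * (s' - s)) (X - x)) (le_trans (ler_normD _ _)) //.
  by rewrite normrM (gtr0_norm x0) -/a mulrDl addrC lerD2l.
have Yy : cabs (Y - y) <= (1 + n) * b.
  rewrite -(subrK ('i%C * y * (t' - t)%:C%C) (Y - y)).
  apply: le_trans (cabsD _ _) _; rewrite 2!cabsM cabs_expi mulr1 cabs_real -/b.
  have -> : cabs ('i%C : Cplx R) = 1.
    by rewrite /cabs /= expr0n expr1n add0r sqrtr1.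
  by rewrite mul1r mulrDl mul1r addrC lerD2l.
have a0 : 0 <= a by exact: normr_ge0.
have b0 : 0 <= b by exact: normr_ge0.
apply: le_trans (cabsD _ _) _; apply: le_trans (lerD (cabsD _ _) (lexx _)) _.
rewrite !cabsM !cabs_real (gtr0_norm x0) cabs_expi mulr1.
have XY : `|X - x| * cabs (Y - y) <= (x + 1) * a * n.
  apply: ler_pM => //; first exact: cabs_ge0.
    by apply: le_trans Xx _; rewrite ler_wpM2r // lerD2l.
  apply: le_trans Yy _; apply: (@le_trans _ _ (2 * b)).
    by rewrite ler_wpM2r //; lra.
  by lra.
have xY : x * cabs (Y - y - 'i%C * y * (t' - t)%:C%C) <= x * (n * b).
  by rewrite ler_wpM2l // ltW.
apply: (@le_trans _ _ (n * (2 * (x + 1)) * (a + b))); last first.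
  by rewrite ler_wpM2r // addr_ge0.
apply: le_trans (lerD (lerD H1 xY) XY) _.
have na : 0 <= n * a by rewrite mulr_ge0 // ltW.
have nb : 0 <= n * b by rewrite mulr_ge0 // ltW.
have xna : 0 <= x * (n * a) by rewrite mulr_ge0 // ltW.
have xnb : 0 <= x * (n * b) by rewrite mulr_ge0 // ltW.
move: na nb xna xnb; clear; lra.
Qed.

Lemma cdiff_polar F s t D e : cdiff F (polar (expR s) t) D -> 0 < e ->
  exists2 d : R, 0 < d & forall s' t', `|s' - s| < d -> `|t' - t| < d ->
  cabs (F (polar (expR s') t') - F (polar (expR s) t)
        - D * polar (expR s) t * ((s' - s) +i* (t' - t))%C)
    <= e * (`|s' - s| + `|t' - t|).
Proof.
set z := polar (expR s) t => FD e0; set x := expR s.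
have x0 : 0 < x by exact: expR_gt0.
have cz : cabs z = x by rewrite cabs_polar gtr0_norm.
pose e1 := e / (2 * (x + 1)).
have e10 : 0 < e1 by rewrite divr_gt0 // mulr_gt0 // ltr_wpDr.
have [d1 d10 H1] := FD _ e10.
pose n := Num.min 1 (e / (2 * (cabs D + 1))).
have D1 : 0 < cabs D + 1 by rewrite ltr_wpDl // cabs_ge0.
have n0 : 0 < n by rewrite lt_min ltr01 divr_gt0 // mulr_gt0.
have n1 : n <= 1 by rewrite ge_min lexx.
have ne : n * (2 * (cabs D + 1)) <= e.
  by rewrite -ler_pdivlMr ?mulr_gt0 // ge_min lexx orbT.
have [d2 d20 H2] := polar_exp_diff s t n0.
pose d3 := d1 / (2 * (x + 1)).
have d30 : 0 < d3 by rewrite divr_gt0 // mulr_gt0 // ltr_wpDr.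
exists (Num.min d2 d3); first by rewrite lt_min d20.
move=> s' t'; rewrite !lt_min => /andP[sd2 sd3] /andP[td2 td3].
have {}H2 := H2 _ _ sd2 td2; rewrite -/z in H2.
set W := ((s' - s) +i* (t' - t))%C in H2 *.
set m := `|s' - s| + `|t' - t| in H2 *.
have m0 : 0 <= m by rewrite addr_ge0.
have cW : cabs W <= m by exact: cabs_ReIm.
set h := polar (expR s') t' - z in H2.
have -> : polar (expR s') t' = z + h by rewrite /h addrC subrK.
have hm : cabs h <= (x + 1) * m.
  rewrite -(subrK (z * W) h); apply: le_trans (cabsD _ _) _.
  rewrite cabsM cz; apply: (@le_trans _ _ (n * m + x * m)).
    by apply: lerD => //; rewrite ler_wpM2l // ltW.
  by rewrite mulrDl mul1r addrC lerD2l ler_piMl.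
have hd : cabs h < d1.
  apply: le_lt_trans hm _; have : m < 2 * d3 by rewrite /m; lra.
  have -> : d1 = (x + 1) * (2 * d3).
    by rewrite /d3; field; apply/lt0r_neq0; rewrite ltr_wpDr.
  by move=> mm; rewrite ltr_pM2l // ltr_wpDr.
have {}H1 := H1 _ hd.
have -> : F (z + h) - F z - D * z * W = (F (z + h) - F z - D * h) + D * (h - z * W).
  ring.
apply: le_trans (cabsD _ _) _; rewrite cabsM.
rewrite (splitr e) mulrDl; apply: lerD.
  apply: le_trans H1 _; apply: (@le_trans _ _ (e1 * ((x + 1) * m))).
    by rewrite ler_wpM2l // ltW.
  have -> : e1 * ((x + 1) * m) = e / 2 * m.
    by rewrite /e1; field; apply/lt0r_neq0; rewrite ltr_wpDr.
  by [].
apply: (@le_trans _ _ (cabs D * (n * m))); first by rewrite ler_wpM2l // cabs_ge0.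
rewrite mulrA ler_wpM2r //.
have : 0 <= n by exact: ltW.
move: ne; clear; lra.
Qed.

Lemma polar_continuous F s t D e : cdiff F (polar (expR s) t) D -> 0 < e ->
  exists2 d : R, 0 < d & forall s' t', `|s' - s| < d -> `|t' - t| < d ->
  cabs (F (polar (expR s') t') - F (polar (expR s) t)) <= e.
Proof.
move=> FD e0; have [d d0 H] := cdiff_polar FD ltr01.
set A := D * polar (expR s) t in H.
have A0 : 0 < cabs A + 1 by rewrite ltr_wpDl // cabs_ge0.
exists (Num.min d (e / (2 * (cabs A + 1)))).
  by rewrite lt_min d0 divr_gt0 // mulr_gt0.
move=> s' t'; rewrite !lt_min => /andP[s1 s2] /andP[t1 t2].
have {}H := H _ _ s1 t1; set W := (_ +i* _)%C in H.
rewrite -(subrK (A * W) (F _ - _)).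
apply: le_trans (cabsD _ _) _; rewrite cabsM.
have cW : cabs W <= `|s' - s| + `|t' - t| by exact: cabs_ReIm.
apply: (@le_trans _ _ ((cabs A + 1) * (`|s' - s| + `|t' - t|))).
  rewrite mulrDl mul1r addrC -[X in _ <= _ + X]mul1r lerD //.
  by rewrite ler_wpM2l // cabs_ge0.
rewrite -ler_pdivlMl // mulrC (_ : e / (cabs A + 1) = e / (2 * (cabs A + 1)) * 2).
  by move: s2 t2; clear; lra.
by field; apply/lt0r_neq0.
Qed.

Lemma circle_continuous F r : 0 < r ->
  (forall t, exists D, cdiff F (polar r t) D) ->
  continuous (fun t => complex.Re (F (polar r t))).
Proof.
move=> r0 hF t; have rE : expR (ln r) = r by rewrite lnK ?posrE.
apply/cvgrPdist_le => /= e e0; have [D hD] := hF t.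
rewrite -rE in hD; have [d d0 H] := polar_continuous hD e0.
exists d => // t' /= tt'; rewrite rE in H.
rewrite -ReB; apply: le_trans (Re_cabs _) _.
rewrite -cabsN opprB; have := H (ln r) t'; rewrite rE; apply.
  by rewrite subrr normr0.
by rewrite distrC.
Qed.

Definition circle_mean F r : R := integral_on 0 (2 * pi) (fun t => complex.Re (F (polar r t))).

(** Goursat's lemma in the chart of [polar_exp_diff], on the rectangle from
    [ln r1] to [ln r2] and from [0] to [2 * pi]: the two sides [t = 0] and [t
    = 2 * pi] cancel by periodicity. *)
Lemma circle_mean_const F r1 r2 : 0 < r1 -> r1 <= r2 ->
  (forall z, r1 <= cabs z <= r2 -> exists D, cdiff F z D) ->
  circle_mean F r1 = circle_mean F r2.
Proof.
move=> r10 r12 hF; have r20 : 0 < r2 by exact: lt_le_trans r12.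
pose a := ln r1; pose b := ln r2.
have ab : a <= b by rewrite ler_ln.
have aE : expR a = r1 by rewrite /a lnK ?posrE.
have bE : expR b = r2 by rewrite /b lnK ?posrE.
(* Clamping the radius makes the integrands continuous on the whole plane. *)
pose cl (s : R) := Num.max a (Num.min s b).
have clab s : a <= cl s <= b.
  rewrite /cl le_max lexx /= ge_max ab /= ge_min lexx orbT //.
have cl_id s : a <= s <= b -> cl s = s.
  by move=> /andP[as_ sb]; rewrite /cl min_l // max_r.
have cl_lip s s' : `|cl s' - cl s| <= `|s' - s|.
  by rewrite /cl !maxEle !minEle; split_ifs; rewrite !ler_norml;
    case: (ger0P (s' - s)); lra.
have hF' s t : exists D, cdiff F (polar (expR (cl s)) t) D.
  apply: hF; rewrite cabs_polar gtr0_norm ?expR_gt0 //.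
  by have /andP[h1 h2] := clab s; rewrite -aE -bE !ler_expR h1.
pose Q s t := complex.Re (F (polar (expR (cl s)) t)).
pose P s t := complex.Im (F (polar (expR (cl s)) t)).
have period (s : R) : P s (2 * pi) = P s 0.
  by rewrite /P /polar /expi mulr_natl cos2pi sin2pi cos0 sin0.
have pi2 : 0 <= 2 * pi :> R by rewrite mulr_ge0 // pi_ge0.
have := @goursat R P Q a b 0 (2 * pi) ab pi2.
have -> : integral_on a b (fun s => P s (2 * pi) - P s 0) = 0.
  have -> : (fun s => P s (2 * pi) - P s 0) = fun=> 0.
    by apply/funext => s; rewrite period subrr.
  by rewrite integral_on_cst // mul0r.
have cQ s : continuous (Q s).
  by apply: circle_continuous => [|t]; [exact: expR_gt0|exact: hF'].
rewrite integral_onB // => G; apply/esym/subr0_eq; rewrite /circle_mean.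
have QE s : Q s = fun t => complex.Re (F (polar (expR (cl s)) t)) by [].
rewrite -bE -aE -{1}(cl_id b) ?ab ?lexx // -{1}(cl_id a) ?ab ?lexx // -!QE G {G} //.
- move=> t s; apply/cvgrPdist_le => /= e e0; have [D hD] := hF' s t.
  have [d d0 H] := polar_continuous hD e0.
  exists d => // s' /= ss'; rewrite -ImB; apply: le_trans (Im_cabs _) _.
  rewrite -cabsN opprB; apply: H; last by rewrite subrr normr0.
  by apply: le_lt_trans (cl_lip _ _) _; rewrite distrC.
- move=> s t sab _; have [D hD] := hF' s t.
  pose A := D * polar (expR (cl s)) t.
  exists (complex.Re A), (- complex.Im A), (complex.Im A) => e e0.
  have [d d0 H] := cdiff_polar hD e0; rewrite -/A in H.
  exists d => // s' t' s'ab _ ss' tt'.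
  rewrite -{1}(cl_id s) // -{1}(cl_id s') // in ss'.
  have := H _ _ ss' tt'; rewrite (cl_id s) // (cl_id s') // => {}H.
  have HR := le_trans (Re_cabs _) H; have HI := le_trans (Im_cabs _) H.
  rewrite /Q /P (cl_id s) // (cl_id s') //; split.
    apply: le_trans HR; rewrite 2!ReB ReM /= le_eqVlt; apply/orP; left; apply/eqP.
    by congr `|_|; congr (_ - _); rewrite mulNr.
  apply: le_trans HI; rewrite 2!ImB ImM /= le_eqVlt; apply/orP; left; apply/eqP.
  by congr `|_|; congr (_ - _); rewrite addrC.
Qed.

End CircleMean.

(** * Gradient of a positive real part *)

Section GradientBound.
Context {R : realType}.
Implicit Types (z w : Cplx R) (t r : R).

Let pi2_gt0 : 0 < 2 * pi :> R. Proof. by rewrite mulr_gt0 // pi_gt0. Qed.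

Let cstC (c : Cplx R) z : derivable (fun=> c) z 1.
Proof. exact: derivable_cst. Qed.

Let invC z : z != 0 -> derivable (fun x : Cplx R => x^-1) z 1.
Proof. by move=> z0; apply: derivableV => //; exact: derivable_id. Qed.

(** This mean does not depend on [r], yet it is proportional to the inverse of
    [r]. *)
Lemma circle_mean_inv (c : Cplx R) r : 0 < r -> circle_mean (fun z => c * z^-1) r = 0.
Proof.
move=> r0.
have hF z : z != 0 -> exists D, cdiff (fun z => c * z^-1) z D.
  move=> z0; exists ('D_1 (fun z : Cplx R => c * z^-1) z).
  by apply: derivable_cdiff; apply: derivableM; [exact: cstC|exact: invC].
have r20 : 0 < r / 2 by rewrite divr_gt0.
have cF (s : R) : 0 < s ->
    continuous (fun t => complex.Re (c * (polar s t)^-1)).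
  move=> s0; apply: (@circle_continuous _ (fun z => c * z^-1)) => // t.
  by apply: hF; rewrite -cabs_eq0 cabs_polar normr_eq0 gt_eqF.
have E : circle_mean (fun z => c * z^-1) (r / 2) = circle_mean (fun z => c * z^-1) r.
  apply: circle_mean_const => //; first by lra.
  by move=> z /andP[zr _]; apply: hF; rewrite -cabs_eq0 gt_eqF //; exact: lt_le_trans zr.
have : integral_on 0 (2 * pi) (fun t => complex.Re (c * (polar r t)^-1) -
    complex.Re (c * (polar (r / 2) t)^-1)) =
    circle_mean (fun z => c * z^-1) r - circle_mean (fun z => c * z^-1) (r / 2).
  by rewrite integral_onB //; exact: cF.
rewrite E subrr.
have -> : (fun t => complex.Re (c * (polar r t)^-1) - complex.Re (c * (polar (r / 2) t)^-1))
  = (fun t => 0 - complex.Re (c * (polar r t)^-1)).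
  apply/funext => t; rewrite sub0r.
  have -> : c * (polar (r / 2) t)^-1 = c * (polar r t)^-1 + c * (polar r t)^-1.
    have -> : (polar r t) = 2 * polar (r / 2) t.
      rewrite /polar mulrA -[2 in RHS]/(2%:R) -(rmorph_nat (real_complex R)) -rmorphM.
      by congr (_%:C%C * _); field.
    have : polar (r / 2) t != 0 by rewrite -cabs_eq0 cabs_polar normr_eq0 gt_eqF.
    by move=> ?; field.
  by rewrite ReD; ring.
rewrite integral_onB; [|exact: cst_continuous|exact: cF].
by rewrite integral_on_cst ?ltW // mul0r sub0r => /eqP; rewrite oppr_eq0 => /eqP.
Qed.

(** With [u] equal to 1 or to -1, the factor [2 + u * (z / r + r / z)] is the
    nonnegative number [2 + 2 * u * cos t] on the circle of radius [r], so
    [F := g * (2 + u * (z / r + r / z))] has a nonnegative mean there. Its mean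
    on a circle of radius [s] is the same, and tends to [2 * pi] times
    [2 * Re g(0) + u * r * Re g'(0)] when [s] tends to 0: the only unbounded term
    [u * r * g(0) / z] has mean zero. *)
Lemma positive_Re_gradient (g : Cplx R -> Cplx R) r : 0 < r ->
  (forall z, cabs z <= r -> derivable g z 1) ->
  (forall z, cabs z <= r -> 0 <= complex.Re (g z)) ->
  r * `|complex.Re ('D_1 g 0)| <= 2 * complex.Re (g 0).
Proof.
move=> r0 dg g0.
suff H (u : R) : u = 1 \/ u = -1 -> 0 <= 2 * complex.Re (g 0) + u * (r * complex.Re ('D_1 g 0)).
  have := H 1 (or_introl erefl); have := H (-1) (or_intror erefl).
  by rewrite -{3}(gtr0_norm r0) -normrM ler_norml; lra.
move=> u1; have uu : `|u| = 1 by case: u1 => ->; rewrite ?normrN normr1.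
set D := 'D_1 g 0.
pose F z := g z * (2 + u%:C%C * (r%:C%C^-1 * z + r%:C%C * z^-1)).
have rC : r%:C%C != 0 :> Cplx R by rewrite -cabs_eq0 cabs_real normr_eq0 gt_eqF.
have hF z : 0 < cabs z <= r -> exists D, cdiff F z D.
  move=> /andP[z0 zr]; exists ('D_1 F z); apply: derivable_cdiff.
  have zn : z != 0 by rewrite -cabs_eq0 gt_eqF.
  apply: derivableM; first exact: dg.
  apply: derivableD; first exact: cstC.
  apply: derivableM; first exact: cstC.
  apply: derivableD.
    by apply: derivableM; [exact: cstC|exact: derivable_id].
  by apply: derivableM; [exact: cstC|exact: invC].
have Fr : 0 <= circle_mean F r.
  rewrite -[leLHS](mul0r (2 * pi - 0)) -(integral_on_cst _ (ltW pi2_gt0)).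
  apply: le_integral_on.
  - exact: cst_continuous.
  - by apply: circle_continuous => // t; apply: hF; rewrite cabs_polar gtr0_norm ?r0 ?lexx.
  move=> t _; rewrite /F.
  have -> : (2 + u%:C%C * (r%:C%C^-1 * polar r t + r%:C%C * (polar r t)^-1) : Cplx R)
      = (2 + u * (2 * cos t))%:C%C.
    have EE : expi t * (cos t -i* sin t)%C = 1 :> Cplx R.
      by apply/eqP; rewrite eq_complex ReM ImM /=; apply/andP; split; apply/eqP;
        [rewrite mulrN opprK -!expr2 cos2Dsin2|ring].
    have -> : (polar r t)^-1 = r%:C%C^-1 * (cos t -i* sin t)%C.
      by rewrite /polar invfM; congr (_ * _); apply: (mulr1_eq EE).
    rewrite /polar (mulrA _ r%:C%C) mulVf // (mulrA r%:C%C) mulfV // !mul1r.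
    have -> : expi t + (cos t -i* sin t)%C = (2 * cos t)%:C%C :> Cplx R.
      by apply/eqP; rewrite eq_complex ReD ImD /=; apply/andP; split; apply/eqP; ring.
    by rewrite -rmorphM -[2 in LHS](rmorph_nat (real_complex R)) -rmorphD.
  rewrite ReM /= mulr0 subr0 mulr_ge0 //.
    by apply: g0; rewrite cabs_polar gtr0_norm.
  have : `|u * (2 * cos t)| <= 2.
    by rewrite normrM uu mul1r normrM ger0_norm // ler_piMr // ler_norml cos_geN1 cos_le1.
  by rewrite ler_norml; lra.
(* On the circle of radius [s] the error terms amount to [s * M + e1 * r]. *)
pose M := 3 * cabs D + 3 + r^-1 * cabs (g 0).
have M0 : 0 < M.
  by rewrite ltr_pwDl ?mulr_ge0 ?invr_ge0 ?cabs_ge0 ?(ltW r0) // ltr_wpDl // mulr_ge0 // cabs_ge0.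
apply/ler_addgt0Pr => e e0.
pose e1 := Num.min 1 (e / (2 * r)).
have e10 : 0 < e1 by rewrite lt_min ltr01 divr_gt0 // mulr_gt0.
have [d d0 Hd] := derivable_cdiff (dg 0 (ltac:(by rewrite cabs0 ltW))) e10.
pose s := Num.min r (Num.min (d / 2) (e / (2 * M))).
have s0 : 0 < s by rewrite !lt_min r0 !divr_gt0 // mulr_gt0.
have sr : s <= r by rewrite ge_min lexx.
have sd : s < d.
  by apply: (@le_lt_trans _ _ (d / 2)); [rewrite !ge_min lexx orbT|lra].
have sM : s * M <= e / 2.
  rewrite -ler_pdivlMr // -mulrA -invfM.
  by apply: (@le_trans _ _ (e / (2 * M))); rewrite ?ge_min ?lexx ?orbT.
have e1r : e1 * r <= e / 2.
  by rewrite -ler_pdivlMr // -mulrA -invfM ge_min lexx orbT.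
have e11 : e1 <= 1 by rewrite ge_min lexx.
have Fs : circle_mean F s = circle_mean F r.
  apply: circle_mean_const => // z /andP[h1 h2]; apply: hF.
  by rewrite h2 andbT; exact: lt_le_trans h1.
have cG (x : R) : 0 < x -> x <= r ->
    continuous (fun t => complex.Re (F (polar x t))).
  by move=> x0 xr; apply: circle_continuous => // t; apply: hF;
    rewrite cabs_polar gtr0_norm // x0.
pose c : Cplx R := (u * r)%:C%C * g 0.
have cH : continuous (fun t => complex.Re (c * (polar s t)^-1)).
  apply: (@circle_continuous _ (fun z => c * z^-1)) => // t.
  exists ('D_1 (fun z : Cplx R => c * z^-1) (polar s t)).
  apply: derivable_cdiff; apply: derivableM; [exact: cstC|apply: invC].
  by rewrite -cabs_eq0 cabs_polar normr_eq0 gt_eqF.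
pose K := 2 * complex.Re (g 0) + u * (r * complex.Re D) + e.
have bound t : complex.Re (F (polar s t)) - complex.Re (c * (polar s t)^-1) <= K.
  set z := polar s t.
  have cz : cabs z = s by rewrite cabs_polar gtr0_norm.
  have z0 : z != 0 by rewrite -cabs_eq0 cz gt_eqF.
  clearbody z; pose p := g z - g 0 - D * z.
  have pz : cabs p <= e1 * s by have := Hd z; rewrite cz add0r => /(_ sd).
  have gz : g z = g 0 + D * z + p by rewrite /p; ring.
  rewrite -ReB.
  have -> : F z - c * z^-1 = 2 * g 0 + (u * r)%:C%C * D +
      (2 * (D * z + p) + u%:C%C * (r%:C%C^-1 * z * (g 0 + D * z + p)) +
       u%:C%C * r%:C%C * (p * z^-1)).
    by rewrite /F /c gz rmorphM /=; field; apply/andP.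
  have -> : 2 * g 0 = 2%:C%C * g 0 :> Cplx R.
    by rewrite -[2 in LHS](rmorph_nat (real_complex R)).
  rewrite 2!ReD 2!ReM /= !mul0r !subr0 /K (mulrA u r) lerD2l.
  apply: le_trans (ler_norm _) _; apply: le_trans (Re_cabs _) _.
  have cu : cabs u%:C%C = 1 by rewrite cabs_real.
  have cr : cabs r%:C%C = r by rewrite cabs_real gtr0_norm.
  have cri : cabs (r%:C%C^-1 : Cplx R) = r^-1 by rewrite /cabs Normc.normcV -/(cabs _) cr.
  have czi : cabs (z^-1) = s^-1 by rewrite /cabs Normc.normcV -/(cabs _) cz.
  have c2 : cabs (2 : Cplx R) = 2.
    by rewrite -(rmorph_nat (real_complex R)) cabs_real ger0_norm.
  have ps : cabs p <= s by apply: le_trans pz _; rewrite ler_piMl // ltW.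
  have Dz : cabs (D * z + p) <= cabs D * s + s.
    by apply: le_trans (cabsD _ _) _; rewrite cabsM cz lerD2l.
  have gb : cabs (g 0 + D * z + p) <= cabs (g 0) + (cabs D * s + s).
    by rewrite -addrA; apply: le_trans (cabsD _ _) _; rewrite lerD2l.
  apply: le_trans (cabsD _ _) _; apply: le_trans (lerD (cabsD _ _) (lexx _)) _.
  rewrite !cabsM c2 cu cr cri czi cz !mul1r.
  have H1 : r * (cabs p / s) <= e / 2.
    apply: le_trans e1r; by rewrite mulrC ler_pM2r // ler_pdivrMr.
  have H2 : r^-1 * s * cabs (g 0 + D * z + p) <= s * (r^-1 * cabs (g 0) + cabs D + 1).
    have -> : r^-1 * s * cabs (g 0 + D * z + p) = s * (r^-1 * cabs (g 0 + D * z + p)).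
      by ring.
    rewrite ler_pM2l //.
    apply: (@le_trans _ _ (r^-1 * (cabs (g 0) + (cabs D * r + r)))).
      rewrite ler_pM2l ?invr_gt0 //; apply: le_trans gb _.
      by rewrite lerD2l lerD // ler_wpM2l // cabs_ge0.
    by rewrite le_eqVlt; apply/orP; left; apply/eqP; field; apply: lt0r_neq0.
  apply: (@le_trans _ _ (s * M + e / 2)); last by move: sM; clear; lra.
  apply: lerD => //.
  apply: le_trans (lerD (ler_wpM2l (ler0n R 2) Dz) H2) _.
  by rewrite /M le_eqVlt; apply/orP; left; apply/eqP; ring.
have : 0 <= K * (2 * pi - 0).
  rewrite -integral_on_cst; last exact: ltW.
  apply: (@le_trans _ _ (integral_on 0 (2 * pi) (fun t => complex.Re (F (polar s t))
      - complex.Re (c * (polar s t)^-1)))).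
    rewrite integral_onB; [|exact: cG|by []].
    have := circle_mean_inv c s0; rewrite /circle_mean => ->.
    by rewrite subr0; move: Fr; rewrite -Fs.
  apply: le_integral_on => //; last exact: cst_continuous.
  by move=> x; apply: cvgB; [exact: cG|exact: cH].
by rewrite subr0 pmulr_lge0 // /K.
Qed.

End GradientBound.

(** * Harnack's inequality *)

Section Harnack.
Context {R : realType}.

Lemma cdiff_Re_is_derive (g : Cplx R -> Cplx R) (t : R) D : cdiff g t%:C%C D ->
  is_derive t (1 : R) (fun s : R => complex.Re (g s%:C%C)) (complex.Re D).
Proof.
move=> gD; have H : (fun h : R => h^-1 *:
    (((fun s : R => complex.Re (g s%:C%C)) \o shift t) (h *: (1 : R)) -
      complex.Re (g t%:C%C))) @ 0^' --> complex.Re D.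
  apply/cvgrPdist_le => e e0; have [d d0 Hd] := gD e e0.
  exists d => // h /=; rewrite sub0r normrN => hd h0.
  have := Hd h%:C%C; rewrite cabs_real => /(_ hd) /(le_trans (Re_cabs _)).
  rewrite 2!ReB ReM /= mulr0 subr0 => Hh.
  rewrite [_ *: (1 : R)]mulr1 (addrC h) (rmorphD (real_complex R)).
  have h0' : 0 < `|h| by rewrite normr_gt0.
  rewrite distrC -(ler_pM2l h0') -normrM.
  rewrite (mulrC `|h|); apply: le_trans Hh; rewrite le_eqVlt; apply/orP; left.
  by apply/eqP; congr `|_|; rewrite mulrBr -[_ *: _]/(_ * _) mulrA mulfV // mul1r (mulrC h).
by apply: DeriveDef; [apply/cvg_ex; exists (complex.Re D)|exact: cvg_lim H].
Qed.

(** The gradient bound on the unit disk around each point of the segment from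
    0 to 1 says that [Re g] grows at most as fast as [expR (2 * t)]. *)
Lemma harnack_disk (g : Cplx R -> Cplx R) :
  (forall z, cabs z <= 2 -> derivable g z 1 /\ 0 <= complex.Re (g z)) ->
  complex.Re (g 1) <= expR 2 * complex.Re (g 0).
Proof.
move=> hg; pose u (t : R) := complex.Re (g t%:C%C).
pose D (t : R) := complex.Re ('D_1 g t%:C%C).
have ct (t : R) : 0 <= t <= 1 -> cabs (t%:C%C : Cplx R) <= 1.
  by move=> /andP[t0 t1]; rewrite cabs_real ger0_norm.
have du (t : R) : 0 <= t <= 1 -> is_derive t (1 : R) u (D t).
  move=> t01; apply/cdiff_Re_is_derive/derivable_cdiff.
  by have [] := hg t%:C%C; [have := ct t t01; lra|].
have Du (t : R) : 0 <= t <= 1 -> D t <= 2 * u t.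
  move=> t01; pose gt (z : Cplx R) : Cplx R := g (z + t%:C%C).
  have in2 z : cabs z <= 1 -> cabs (z + t%:C%C) <= 2.
    by move=> z1; apply: le_trans (cabsD _ _) _; have := ct t t01; lra.
  have dgt (z : Cplx R) : derivable g (z + t%:C%C : Cplx R) 1 ->
      derivable gt z 1 /\ 'D_1 gt z = 'D_1 g (z + t%:C%C : Cplx R).
    rewrite /derivable /derive /gt /= => dz.
    have -> : (fun h : Cplx R => h^-1 *:
        (((fun z : Cplx R => g (z + t%:C%C) : Cplx R) \o shift z) h%:A - g (z + t%:C%C)))
       = (fun h => h^-1 *: ((g \o shift (z + t%:C%C)) h%:A - g (z + t%:C%C))).
      by apply/funext => h /=; rewrite addrA.
    by [].
  have := @positive_Re_gradient R gt 1 ltr01.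
  have -> : 'D_1 gt 0 = 'D_1 g t%:C%C.
    have := dgt 0; rewrite add0r; case=> //.
    by have [] := hg t%:C%C; [have := ct t t01; lra|].
  have -> : gt 0 = g t%:C%C by rewrite /gt add0r.
  rewrite mul1r => H; apply: le_trans (ler_norm _) _; apply: H.
    by move=> z /in2 /hg [/dgt []].
  by move=> z /in2 /hg [].
pose v := fun t : R => u t * expR (- 2 * t).
have dv (t : R) : 0 <= t <= 1 ->
    is_derive t (1 : R) v ((D t - 2 * u t) * expR (- 2 * t)).
  move=> t01; have dut := du t t01.
  have de : is_derive t (1 : R) (fun t => expR (- 2 * t)) (- 2 * expR (- 2 * t)).
    have dl : is_derive t (1 : R) (fun t : R => - 2 * t) (- 2).
      by apply: is_derive_eq; rewrite [_ *: _]mulr1.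
    apply: (@is_derive_eq _ _ _ _ _ _ _ _
      (is_derive1_comp (f := expR) (g := fun t => - 2 * t) _ dl)).
    by rewrite [LHS]mulrC.
  apply: is_derive_eq; rewrite ![_ *: _]mulrC; ring.
have : v 1 <= v 0.
  apply: (@ler0_derive1_nincr _ v 0 1) => //.
  - by move=> t; rewrite in_itv /= => /andP[t0 t1];
      have [] := dv t _; rewrite ?(ltW t0) ?(ltW t1).
  - move=> t; rewrite in_itv /= => /andP[t0 t1].
    have t01 : 0 <= t <= 1 by rewrite !ltW.
    have [_] := dv t t01; rewrite derive1E => ->.
    by rewrite pmulr_lle0 ?expR_gt0 // subr_le0 Du.
  - apply: derivable_within_continuous => t; rewrite in_itv /= => t01.
    by have [] := dv t t01.
rewrite /v /u mulr1 mulr0 expR0 mulr1 expRN => H.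
by rewrite mulrC -ler_pdivrMr ?expR_gt0.
Qed.

(** The class of [x] and the union of the other classes are both open in [A].
    *)
Lemma connected_related (T : topologicalType) (A : set T) (r : T -> T -> Prop) :
  open A -> connected A -> (forall x y, r x y -> r y x) ->
  (forall x y z, r x y -> r y z -> r x z) ->
  (forall x, A x -> \forall y \near x, r x y) ->
  forall x y, A x -> A y -> r x y.
Proof.
move=> oA cA rs rt rn x y Ax Ay.
suff : [set z | A z /\ r x z] = A by move=> E; have : A y by []; rewrite -E => -[].
apply: cA.
- by exists x; split => //; exact: nbhs_singleton (rn x Ax).
- exists [set z | A z /\ r x z]; last by apply/seteqP; split => z [] //= Az [].
  rewrite openE => z [Az xz]; have := rn z Az; have := open_nbhs_nbhs (conj oA Az).
  by apply: filterS2 => w Aw zw; split => //; exact: rt xz zw.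
- exists (~` [set z | A z /\ ~ r x z]).
    apply: open_closedC; rewrite openE => z [Az xz].
    have := rn z Az; have := open_nbhs_nbhs (conj oA Az).
    apply: filterS2 => w Aw zw; split => // xw; apply: xz; apply: rt xw _.
    exact: rs.
  apply/seteqP; split => z /=; first by move=> [Az xz]; split => // -[].
  by move=> [Az nz]; split => //; apply: contrapT => xz; apply: nz.
Qed.

Variable n : nat.
Local Notation V := 'rV[Cplx R]_n.
Variable U : set V.
Hypothesis oU : open U.

Definition holo_pos (h : V -> Cplx R) :=
  forall z, U z -> differentiable h z /\ 0 <= complex.Re (h z).

(** The constant does not depend on the function; symmetric and transitive up
    to multiplying constants, hence usable with [connected_related]. *)
Definition harnack_const (C : R) (x y : V) := 0 <= C /\ forall h, holo_pos h ->
  complex.Re (h y) <= C * complex.Re (h x) /\ complex.Re (h x) <= C * complex.Re (h y).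

(** Close to [x], the complex line through two points stays in the open set on
    a disk of radius twice their distance, where [harnack_disk] applies. *)
Lemma harnack_near x : U x -> \forall y \near x, harnack_const (expR 2) x y.
Proof.
move=> Ux; have /nbhs_ballP[e /= e0 xeU] := open_nbhs_nbhs (conj oU Ux).
have e4 : 0 < e / 4 by rewrite divr_gt0.
apply: filterS (nbhsx_ballx x _ e4) => y; rewrite -ball_normE /= => xy.
have in_U (p : V) (z : Cplx R) (w : V) : `|x - p| < e / 4 -> `|w| < e / 4 ->
    cabs z <= 2 -> U (p + z *: w).
  move=> xp we z2; apply: xeU; rewrite -ball_normE /= opprD addrA.
  apply: le_lt_trans (ler_normB _ _) _; rewrite normrZ.
  have nz : `|z| <= 2.
    rewrite -[2 in leRHS](rmorph_nat (real_complex R)) normcE lecR; exact: z2.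
  have zw : `|z| * `|w| <= 2 * `|w| by rewrite ler_wpM2r.
  have -> : e = e / 4 + 2 * (e / 4) + e / 4 by field.
  rewrite -[ltLHS]addr0; apply: ltrD => //; apply: ltrD => //.
  by apply: le_lt_trans zw _; rewrite ltr_pM2l.
have seg (p q : V) h : `|x - p| < e / 4 -> `|q - p| < e / 4 -> holo_pos h ->
    complex.Re (h q) <= expR 2 * complex.Re (h p).
  move=> xp qp hh; pose g (z : Cplx R) := h (p + z *: (q - p)).
  have -> : h q = g 1 by rewrite /g scale1r addrC subrK.
  have -> : h p = g 0 by rewrite /g scale0r addr0.
  apply: harnack_disk.
  move=> z z2; have Uz := in_U p z (q - p) xp qp z2.
  have [dh h0] := hh _ Uz; split => //; apply/derivable1_diffP.
  apply: (differentiable_comp (f := fun z : Cplx R => p + z *: (q - p))) => //.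
split; first exact: expR_ge0.
move=> h hh; split; apply: seg => //; rewrite ?subrr ?normr0 //.
by rewrite distrC.
Qed.

Lemma harnack_const_sym C x y : harnack_const C x y -> harnack_const C y x.
Proof. by move=> [C0 H]; split => // h /H[]. Qed.

Lemma harnack_const_trans C D x y z : harnack_const C x y -> harnack_const D y z ->
  harnack_const (C * D) x z.
Proof.
move=> [C0 H] [D0 G]; split; first exact: mulr_ge0.
move=> h hh; have [H1 H2] := H h hh; have [G1 G2] := G h hh; split.
  by apply: le_trans G1 _; rewrite (mulrC C) -mulrA ler_wpM2l.
by apply: le_trans H2 _; rewrite -mulrA ler_wpM2l.
Qed.

(** Constants multiply along chains, so connectedness compares all points with
    [x0]; compactness makes the constant uniform. *)
Lemma harnack_compact (K : set V) x0 : connected U -> compact K -> K `<=` U -> U x0 ->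
  exists C : R, 1 <= C /\ forall y, K y -> harnack_const C x0 y.
Proof.
move=> cU cK KU Ux0.
have rel y : U y -> exists C : R, harnack_const C x0 y.
  move=> Uy; apply: (@connected_related _ U (fun x y => exists C, harnack_const C x y)) => //.
  - by move=> x z [C H]; exists C; exact: harnack_const_sym.
  - by move=> x z w [C H] [D G]; exists (C * D); exact: harnack_const_trans H G.
  - by move=> x Ux; apply: filterS (harnack_near Ux) => z H; exists (expR 2).
have := (@compact_near_coveringP _ K).1 cK nat \oo
  (fun m y => U y -> harnack_const (m.+1%:R) x0 y).
case.
  move=> y Ky; have [C CH] := rel y (KU _ Ky).
  have C2 : 0 <= C * expR 2 by rewrite mulr_ge0 ?expR_ge0 //; case: CH.
  exists ([set z | harnack_const (expR 2) y z], [set m | (Num.truncn (C * expR 2) <= m)%N]).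
    split => /=; first exact: harnack_near (KU _ Ky).
    by exists (Num.truncn (C * expR 2)).
  move=> [z m] /= [yz Cm] Uz.
  have [_ H] := harnack_const_trans CH yz; split; first exact: ler0n.
  have Cm' : C * expR 2 <= m.+1%:R.
    apply: ltW; apply: lt_le_trans (truncnS_gt _) _.
    by rewrite ler_nat ltnS.
  move=> h hh; have [H1 H2] := H h hh; split.
    apply: le_trans H1 _; rewrite ler_wpM2r //; exact: (hh _ Ux0).2.
  by apply: le_trans H2 _; rewrite ler_wpM2r //; exact: (hh _ Uz).2.
move=> m _ Hm; exists m.+1%:R; split; first by rewrite ler1n.
by move=> y Ky; apply: Hm => /=; [exact: leqnn|exact: Ky|exact: KU].
Qed.

End Harnack.

(** * Iterates of a holomorphic map with relatively compact image *)

Lemma mx_entry_norm (K : numFieldType) m n (x : 'M[K]_(m, n)) i j :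
  `|x i j| <= `|x|.
Proof.
rewrite [leRHS]mx_normE -[leLHS]nngE num_le.
exact: (le_bigmax _ (fun ij => `|x ij.1 ij.2|%:nng) (i, j)).
Qed.

Section Iterates.
Context {R : realType} (n : nat).
Local Notation V := 'rV[Cplx R]_n.
Variables (U K : set V) (f : V -> V).
Hypothesis oU : open U.
Hypothesis cU : connected U.
Hypothesis bU : bounded_set U.
Hypothesis cK : compact K.
Hypothesis KU : K `<=` U.
Hypothesis fK : forall z, U z -> K (f z).
Hypothesis df : forall z, U z -> differentiable f z.
Variable z0 : V.
Hypothesis Uz0 : U z0.

Lemma iter_stays N z : U z -> U (iter N f z).
Proof. by move=> Uz; elim: N => //= N /fK /KU. Qed.

Lemma iter_differentiable N z : U z -> differentiable (iter N f) z.
Proof.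
elim: N => [|N IH] Uz /=; first exact: ex_diff.
apply: (differentiable_comp (f := iter N f) (g := f)); first exact: IH.
exact/df/iter_stays.
Qed.

(** Let [m] and [m + E] bound the function on [U]. At the point [f z0] of [K],
    the value is at distance at least [E / 2] from one of the two bounds; by
    Harnack's inequality the function stays at distance at least [E / (2 * C)]
    from that bound on [K]. As [f] maps into [K], composing with [f] shortens
    the range by the factor [1 - 1 / (2 * C)]. *)
Lemma coordinate_oscillation (c : Cplx R) (i : 'I_n) : exists D q : R,
  [/\ 0 <= q, q < 1 & forall N, exists m : R, forall y, U y ->
    m <= complex.Re (c * iter N f y 0 i) <= m + D * q ^+ N].
Proof.
have [B hB] : exists B : R, forall y, U y -> `|complex.Re (c * y 0 i)| <= B.
  have [M _ hM] := pinfty_ex_gt0 bU.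
  exists (cabs c * complex.Re M) => y Uy.
  apply: le_trans (Re_cabs _) _; rewrite cabsM ler_wpM2l ?cabs_ge0 //.
  have : `|y 0 i| <= M.
    by apply: le_trans (mx_entry_norm _ _ _) (hM y Uy).
  by rewrite normcE lecE => /andP[_].
have [C [C1 HC]] := harnack_compact oU cU cK KU (KU (fK Uz0)).
have C0 : 0 < C by exact: lt_le_trans C1.
have iC : C^-1 <= 1 by rewrite invf_le1.
have iC0 : 0 < C^-1 by rewrite invr_gt0.
pose q := 1 - C^-1 / 2.
exists (2 * B), q; split; [by rewrite /q; lra|by rewrite /q; lra|].
elim=> [|N [m IH]].
  by exists (- B) => y /hB; rewrite ler_norml expr0 mulr1 /=; lra.
set E := 2 * B * q ^+ N in IH.
pose h1 (y : V) : Cplx R := c * iter N f y 0 i - m%:C%C.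
pose h2 (y : V) : Cplx R := (m + E)%:C%C - c * iter N f y 0 i.
have dh y : U y -> differentiable (fun y => c * iter N f y 0 i : Cplx R) y.
  move=> Uy; apply: differentiableM => //.
  apply: (differentiable_comp (g := fun v : V => v 0 i : Cplx R)).
    exact: iter_differentiable.
  exact: differentiable_coord.
have h1P : holo_pos U h1.
  move=> y Uy; split; last by rewrite /h1 ReB /=; have := IH y Uy; lra.
  by apply: differentiableB => //; exact: dh.
have h2P : holo_pos U h2.
  move=> y Uy; split; last by rewrite /h2 ReB /=; have := IH y Uy; lra.
  by apply: differentiableB => //; exact: dh.
have EqE : 2 * B * q ^+ N.+1 = E - E / 2 * C^-1 by rewrite exprS /q /E; ring.
rewrite EqE.
have [le|gt] := leP (E / 2) (complex.Re (h1 (f z0))).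
  exists (m + E / 2 * C^-1) => y Uy; rewrite iterSr.
  have [_ H] := (HC _ (fK Uy)).2 h1 h1P.
  have /andP[_ H2] := IH _ (KU (fK Uy)).
  have : E / 2 * C^-1 <= complex.Re (h1 (f y)).
    by rewrite ler_pdivrMr // (mulrC _ C); exact: le_trans le H.
  by rewrite /h1 ReB /=; move: H2; lra.
exists m => y Uy; rewrite iterSr.
have [_ H] := (HC _ (fK Uy)).2 h2 h2P.
have /andP[H2 _] := IH _ (KU (fK Uy)).
have : E / 2 * C^-1 <= complex.Re (h2 (f y)).
  rewrite ler_pdivrMr // (mulrC _ C); apply: le_trans H.
  by move: gt; rewrite /h1 /h2 !ReB /=; lra.
by rewrite /h2 ReB /=; move: H2; lra.
Qed.

Lemma iterates_contract (e : R) : 0 < e -> exists N, forall y y', U y -> U y' ->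
  ball (iter N f y) (e%:C%C : Cplx R) (iter N f y').
Proof.
move=> e0; have e3 : 0 < e / 3 by rewrite divr_gt0.
have osc c : \forall N \near \oo, forall i : 'I_n, forall y y', U y -> U y' ->
    `|complex.Re (c * iter N f y 0 i) - complex.Re (c * iter N f y' 0 i)| <= e / 3.
  apply: filter_forall => i; have [D [q [q0 q1 H]]] := coordinate_oscillation c i.
  have := @cvg_geometric R D q; rewrite ger0_norm // => /(_ q1) /cvgr_le /(_ _ e3).
  apply: filterS => N /= DN y y' Uy Uy'; have [m Hm] := H N.
  have := Hm _ Uy; have := Hm _ Uy'.
  rewrite ler_norml; move: DN; rewrite /geometric /=; lra.
have [N [H1 Hi]] := filter_ex (filterI (osc 1) (osc (- 'i%C))).
exists N => y y' Uy Uy'; split => [|k i]; first by rewrite ltcR.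
rewrite (ord1 k) -ball_normE /= normcE ltcR.
apply: (@le_lt_trans _ _ (e / 3 + e / 3)); last by move: e0; lra.
apply: le_trans (cabs_ReIm _) _; apply: lerD.
  by have := H1 i y y' Uy Uy'; rewrite !mul1r -ReB.
have := Hi i y y' Uy Uy'; rewrite -ReB -mulrBr.
by rewrite ReM /= !oppr0 mul0r sub0r mulN1r opprK.
Qed.

Lemma lebesgue_radius : exists2 e : R, 0 < e &
  forall x, K x -> ball x (e%:C%C : Cplx R) `<=` U.
Proof.
have He : \forall e \near at_right (0 : R),
    K `<=` (fun x => ball x (e%:C%C : Cplx R) `<=` U).
  apply: ((@compact_near_coveringP _ K).1 cK R (at_right 0)
    (fun e x => ball x (e%:C%C : Cplx R) `<=` U)) => x Kx.
  have /nbhs_ballP[e /= e0 xeU] := open_nbhs_nbhs (conj oU (KU Kx)).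
  have e2 : 0 < e / 2 by rewrite divr_gt0.
  have eE : e / 2 = (complex.Re (e / 2))%:C%C :> R[i].
    by apply/esym/RRe_real; exact: gtr0_real.
  have e2' : 0 < complex.Re (e / 2) by rewrite -ltcR -eE.
  exists (ball x (e / 2), [set r : R | r < complex.Re (e / 2)]).
    split => /=; first exact: (nbhsx_ballx x _ e2).
    exact: nbhs_right_lt.
  move=> [y r] /= [xy re] w yw; apply: xeU.
  rewrite (splitr e); apply: ball_triangle xy _.
  by apply: le_ball yw; rewrite eE lecR ltW.
have [d [d0 Hd]] := filter_ex (filterI (nbhs_right_gt (0 : R)) He).
by exists d.
Qed.

(** A late iterate has a small range that meets [K], and the points of [K] stay
    at a fixed distance from the complement of [U]. *)
Lemma iterates_shrink : exists N (p : V) (r : Cplx R),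
  [/\ 0 < r, ball p r `<=` U & forall y, U y -> ball p r (iter N f y)].
Proof.
have [e e0 He] := lebesgue_radius; have [N HN] := iterates_contract e0.
exists N.+1, (f (iter N f z0)), e%:C%C; split; first by rewrite ltcR.
  by apply: He; apply: fK; exact: iter_stays.
move=> y Uy; rewrite iterSr -iterS iterSr; apply: HN; exact/KU/fK.
Qed.

End Iterates.

(** * Continuity rules and quotient maps *)

Lemma rV_norm_le (R : realType) k (x : 'rV[R]_k) (c : R) : 0 <= c ->
  (forall i, `|x 0 i| <= c) -> `|x| <= c.
Proof.
move=> c0 H; rewrite [leLHS]mx_normrE; apply: bigmax_le => // -[i j] _ /=.
by rewrite (ord1 i).
Qed.

Section ContinuityRules.
Context {R : realType} {T : topologicalType} {W : normedModType R}.

Lemma fun_continuousD (f g : T -> W) :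
  continuous f -> continuous g -> continuous (fun x => f x + g x).
Proof. by move=> cf cg x; apply: cvgD; [exact: cf|exact: cg]. Qed.

Lemma fun_continuousB (f g : T -> W) :
  continuous f -> continuous g -> continuous (fun x => f x - g x).
Proof. by move=> cf cg x; apply: cvgB; [exact: cf|exact: cg]. Qed.

Lemma fun_continuousM (f g : T -> R) :
  continuous f -> continuous g -> continuous (fun x => f x * g x).
Proof. by move=> cf cg x; apply: cvgM; [exact: cf|exact: cg]. Qed.

Lemma fun_continuousZ (f : T -> R) (g : T -> W) :
  continuous f -> continuous g -> continuous (fun x => f x *: g x).
Proof. by move=> cf cg x; apply: cvgZ; [exact: cf|exact: cg]. Qed.

Lemma fun_continuousV (f : T -> R) : (forall x, f x != 0) ->
  continuous f -> continuous (fun x => (f x)^-1).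
Proof. by move=> f0 cf x; apply: cvgV; [exact: f0|exact: cf]. Qed.

Lemma fun_continuous_norm (f : T -> W) :
  continuous f -> continuous (fun x => `|f x|).
Proof. by move=> cf x; apply: cvg_norm; exact: cf. Qed.

End ContinuityRules.

Lemma fun_continuous_id (T : topologicalType) : continuous (fun x : T => x).
Proof. by move=> x; exact: cvg_id. Qed.

Lemma fun_continuous_fst (T U V : topologicalType) (f : T -> U * V) :
  continuous f -> continuous (fun x => (f x).1).
Proof. by move=> cf x; apply: cvg_comp; [exact: cf|exact: cvg_fst]. Qed.

Lemma fun_continuous_snd (T U V : topologicalType) (f : T -> U * V) :
  continuous f -> continuous (fun x => (f x).2).
Proof. by move=> cf x; apply: cvg_comp; [exact: cf|exact: cvg_snd]. Qed.

Lemma continuous_comp_fun (T U V : topologicalType) (f : T -> U) (g : U -> V) :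
  continuous f -> continuous g -> continuous (fun x => g (f x)).
Proof. by move=> cf cg x; apply: continuous_comp; [exact: cf|exact: cg]. Qed.

(* Only the head symbol of the function is inspected, so no unification is
   wasted on the rules that do not apply. *)
Ltac continuity := repeat
  lazymatch goal with
  | |- forall x, continuous_at x (fun _ => ?c) => exact: cst_continuous
  | |- forall x, continuous_at x (fun y => y) => exact: fun_continuous_id
  | |- forall x, continuous_at x (fun y => (@?f y, @?g y)) =>
      apply: (@continuous_pair _ _ _ f g)
  | |- forall x, continuous_at x (fun y => @GRing.add _ (@?f y) (GRing.opp (@?g y))) =>
      apply: (@fun_continuousB _ _ _ f g)
  | |- forall x, continuous_at x (fun y => @GRing.add _ (@?f y) (@?g y)) =>
      apply: (@fun_continuousD _ _ _ f g)
  | |- forall x, continuous_at x (fun y => @GRing.mul _ (@?f y) (@?g y)) =>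
      apply: (@fun_continuousM _ _ f g)
  | |- forall x, continuous_at x (fun y => @GRing.scale _ _ (@?f y) (@?g y)) =>
      apply: (@fun_continuousZ _ _ _ f g)
  | |- forall x, continuous_at x (fun y => Num.Def.normr (@?f y)) =>
      apply: (@fun_continuous_norm _ _ _ f)
  | |- forall x, continuous_at x (fun y => GRing.inv (@?f y)) =>
      apply: (@fun_continuousV _ _ f)
  | |- forall x, continuous_at x fst => move=> ?; exact: cvg_fst
  | |- forall x, continuous_at x snd => move=> ?; exact: cvg_snd
  | |- forall x, continuous_at x (fun y => fst (@?f y)) =>
      apply: (@fun_continuous_fst _ _ _ f)
  | |- forall x, continuous_at x (fun y => snd (@?f y)) =>
      apply: (@fun_continuous_snd _ _ _ f)
  | _ => assumption
  end.

(** The preimage of a closed set under [psi] is the image of a compact set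
    under [q]. *)
Lemma quotient_continuous (T Y X : topologicalType) (A : set T) (q : T -> Y)
    (h : T -> X) (psi : Y -> X) : hausdorff_space Y -> compact A ->
  {within A, continuous q} -> {within A, continuous h} ->
  (forall a, A a -> psi (q a) = h a) -> {within q @` A, continuous psi}.
Proof.
move=> hY cA cq /continuous_closedP ch psiq; apply/continuous_closedP => D cD.
have /closed_subspaceP[W cW WE] := ch _ cD.
apply/closed_subspaceP; exists (q @` (A `&` W)).
  apply: compact_closed => //; apply: continuous_compact.
    by apply: continuous_subspaceW cq; exact: subIsetl.
  exact: compact_closedI.
rewrite /from_subspace in WE *; apply/seteqP; split => y /=.
  move=> [[a [Aa Wa] <-] _]; split; last by exists a.
  rewrite /from_subspace psiq //; have : (W `&` A) a by [].
  by rewrite WE => -[].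
move=> [Dy [a Aa ay]]; split; last by exists a.
exists a => //; split => //; have : (h @^-1` D `&` A) a.
  by split => //=; rewrite -psiq // ay.
by rewrite -WE => -[].
Qed.

(** * Wrapping a ball around a sphere *)

Section SphereParametrization.
Context {R : realType} {k : nat}.
Local Notation V := 'rV[R]_k.
Implicit Types (t : V) (p : R * V).

Definition disk {W : normedModType R} : set W := [set t | `|t| <= 1].
Definition sphere {W : normedModType R} : set W := [set t | `|t| = 1].

(** Follows, in the direction of [t], a path from the north pole [(1, 0)] at
    [t = 0] to the south pole [(-1, 0)] at norm 1, on a curve that avoids the
    origin; [wrap] projects it to the sphere. Thus [wrap] collapses the
    boundary of the ball to the south pole and is injective inside. *)
Definition meridian t : R * V := (1 - 2 * `|t|, (1 - `|t|) *: t).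

Definition wrap t : R * V := `|meridian t|^-1 *: meridian t.

Lemma meridian_neq0 t : meridian t != 0.
Proof.
apply/eqP => -[t2 /eqP]; rewrite scaler_eq0 => /orP[/eqP h|/eqP h]; move: t2.
  by lra.
by rewrite h normr0 mulr0 subr0 => /eqP; rewrite oner_eq0.
Qed.

Lemma wrap_norm t : `|wrap t| = 1.
Proof.
by rewrite normrZ normfV normr_id mulVf // normr_eq0 meridian_neq0.
Qed.

Lemma meridian_continuous : continuous meridian.
Proof. by rewrite /meridian; continuity. Qed.

Lemma wrap_continuous : continuous wrap.
Proof.
rewrite /wrap; continuity; try exact: meridian_continuous.
by move=> t; rewrite normr_eq0 meridian_neq0.
Qed.

Lemma wrap_boundary t : sphere t -> wrap t = (-1, 0).
Proof.
move=> /= t1; rewrite /wrap /meridian t1 subrr scale0r mulr1.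
have -> : 1 - 2 = -1 :> R by ring.
rewrite prod_normE /= normrN normr1 normr0 maxEle ler10 invr1 scale1r.
by [].
Qed.

(** For [a] the norm of [t], the ratio [(1 - 2 * a) / (a * (1 - a))] of the
    two components of [meridian t] strictly decreases with [a]. *)
Lemma wrap_inj t t' : disk t -> disk t' -> wrap t = wrap t' ->
  t = t' \/ (sphere t /\ sphere t').
Proof.
move=> /= t1 t1' tt'.
pose l := `|meridian t| / `|meridian t'|.
have m0 : 0 < `|meridian t| by rewrite normr_gt0 meridian_neq0.
have m0' : 0 < `|meridian t'| by rewrite normr_gt0 meridian_neq0.
have l0 : 0 < l by rewrite divr_gt0.
have E : meridian t = l *: meridian t'.
  rewrite /l -scalerA -/(wrap t') -tt' scalerA mulfV ?scale1r //.
  exact: lt0r_neq0.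
clearbody l.
have E1 : 1 - 2 * `|t| = l * (1 - 2 * `|t'|) by case: E.
have E2 : (1 - `|t|) *: t = l *: ((1 - `|t'|) *: t') by case: E.
have E3 : (1 - `|t|) * `|t| = l * ((1 - `|t'|) * `|t'|).
  have := congr1 Num.norm E2; rewrite !normrZ (gtr0_norm l0).
  by rewrite !ger0_norm // subr_ge0.
set a := `|t| in t1 E1 E2 E3; set b := `|t'| in t1' E1 E2 E3.
have a0 : 0 <= a by exact: normr_ge0.
have b0 : 0 <= b by exact: normr_ge0.
have ab : a = b.
  have : (b - a) * ((1 - a) * (1 - b) + a * b) = 0.
    have : (1 - 2 * a) * ((1 - b) * b) = (1 - 2 * b) * ((1 - a) * a).
      by rewrite E1 E3; ring.
    by move=> H; rewrite -[RHS](subrr ((1 - 2 * a) * ((1 - b) * b))) {2}H; ring.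
  move=> /eqP; rewrite mulf_eq0 subr_eq0 => /orP[/eqP -> //|/eqP h].
  have u0 : 0 <= (1 - a) * (1 - b) by rewrite mulr_ge0 // subr_ge0.
  have v0 : 0 <= a * b by rewrite mulr_ge0.
  have h1 : (1 - a) * (1 - b) = 0 by lra.
  have h2 : a * b = 0 by lra.
  move/eqP: h2; rewrite mulf_eq0 => /orP[]/eqP hh; move: h1; rewrite hh; move=> h1; exfalso.
    have bb : b = 1 by lra.
    move: E3; rewrite hh bb; move: E1; rewrite hh bb; nra.
  have aa : a = 1 by lra.
  move: E1; rewrite hh aa; nra.
have [a1|a1] := eqVneq a 1; first by right; rewrite /sphere /= -/a -/b -ab a1.
left; have l1 : l = 1.
  have [h|h] := eqVneq (1 - 2 * b) 0.
    have bb : (1 - b) * b != 0.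
      have hb : b = 2^-1 by lra.
      by rewrite hb; apply/eqP; lra.
    by apply: (mulIf bb); rewrite mul1r -E3 ab.
  by apply: (mulIf h); rewrite mul1r -E1 ab.
have a1' : 1 - b != 0 by rewrite subr_eq0 eq_sym -ab.
by move: E2; rewrite l1 scale1r ab => /(scalerI a1').
Qed.

Hypothesis k0 : (0 < k)%N.

Lemma norm_const_mx1 : `|const_mx 1 : V| = 1.
Proof.
apply/le_anti/andP; split; first by apply: rV_norm_le => // i; rewrite mxE normr1.
by have := mx_entry_norm (const_mx 1 : V) 0 (Ordinal k0); rewrite mxE normr1.
Qed.

(** The two poles have explicit preimages; for the other points, the norm of
    the preimage is a root given by the intermediate value theorem. *)
Lemma wrap_surj p : sphere p -> exists2 t, disk t & wrap t = p.
Proof.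
case: p => b a /=; rewrite /sphere /= prod_normE /= => ab1.
suff [t [c [t1 c0 tE]]] : exists t c, [/\ disk t, 0 < c & meridian t = c *: (b, a)].
  exists t => //; rewrite /wrap tE normrZ prod_normE /= ab1 mulr1 gtr0_norm //.
  by rewrite scalerA mulVf ?scale1r // lt0r_neq0.
have [a0|a0] := eqVneq a 0.
  have b1 : `|b| = 1.
    by move: ab1; rewrite a0 normr0 max_l.
  have [bp|bn] := leP 0 b.
    exists 0, 1; split => //; first by rewrite /disk /= normr0.
    rewrite /meridian normr0 mulr0 !subr0 scaler0 scale1r a0.
    by rewrite -b1 ger0_norm.
  have n1 := norm_const_mx1.
  exists (const_mx 1), 1; split => //; first by rewrite /disk /= n1.
  rewrite /meridian n1 subrr scale0r scale1r a0; congr pair.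
  by move: b1; rewrite ltr0_norm // => b1; lra.
pose al := `|a|; have al0 : 0 < al by rewrite normr_gt0.
have [r] : exists2 r, r \in `[0, 1] & (1 - 2 * r) * al - b * (r * (1 - r)) = 0.
  apply: IVT => //.
    by apply: continuous_subspaceT; continuity.
  by rewrite minEle maxEle; case: ifP => h; lra.
rewrite in_itv /= => /andP[r0 r1] rE.
have r00 : r != 0.
  by apply/eqP => h; move: rE; rewrite h !mul0r mulr0 subr0 mulr0 subr0 mul1r => h'; lra.
have r11 : r != 1.
  by apply/eqP => h; move: rE; rewrite h => h'; lra.
have r0' : 0 < r by rewrite lt_def r00.
have r1' : r < 1 by rewrite lt_def eq_sym r11.
exists ((r / al) *: a), (r * (1 - r) / al).
have nt : `|(r / al) *: a| = r.
  by rewrite normrZ -/al ger0_norm ?divr_ge0 ?(ltW al0) // divfK // lt0r_neq0.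
split; first by rewrite /disk /= nt.
  by rewrite divr_gt0 // mulr_gt0 // subr_gt0.
rewrite /meridian nt; congr pair => /=.
  rewrite -[_ *: _]/(_ * _) mulrAC; apply: (mulIf (lt0r_neq0 al0)).
  by rewrite divfK ?lt0r_neq0 //; lra.
by rewrite scalerA; congr (_ *: _); ring.
Qed.

End SphereParametrization.

(** * Free homotopies of spheroids *)

Section FreeHomotopy.
Context {R : realType} {X : topologicalType} {k : nat}.
Local Notation V := 'rV[R]_k.
Implicit Types (g h l : V -> X) (x : X).

Definition slab : set (R * V) := `[0, 1]%classic `*` disk.

Definition homotopy_between g h (H : R * V -> X) :=
  [/\ {within slab, continuous H}, forall t, disk t -> H (0, t) = g t &
      forall t, disk t -> H (1, t) = h t].

(** Each stage is constant on the boundary of the ball, but the constant may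
    depend on the stage: the base point is allowed to move. *)
Definition free_homotopic g h := exists2 H, homotopy_between g h H &
  forall s : R, 0 <= s <= 1 -> exists x, forall t, sphere t -> H (s, t) = x.

Definition based_homotopic x g h := exists2 H, homotopy_between g h H &
  forall (s : R) t, 0 <= s <= 1 -> sphere t -> H (s, t) = x.

Definition null g := exists x, free_homotopic g (fun=> x).

Lemma closed_disk (W : normedModType R) : closed (@disk R W).
Proof.
have -> : @disk R W = (fun t : W => `|t|) @^-1` [set s | s <= 1] by [].
by apply: closed_comp; [move=> t _; exact: norm_continuous|exact: closed_le].
Qed.

Lemma closed_slab : closed slab.
Proof.
have -> : slab = (fst @^-1` `[0, 1]%classic) `&` (snd @^-1` disk) by [].
apply: closedI.
  by apply: closed_comp; [move=> a _; exact: cvg_fst|exact: interval_closed].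
by apply: closed_comp; [move=> a _; exact: cvg_snd|exact: closed_disk].
Qed.

Lemma compact_slab : compact slab.
Proof.
apply: compact_setX; first exact: segment_compact.
apply: bounded_closed_compact; last exact: closed_disk.
by exists 1; split => // M M1 t /= t1; apply: le_trans t1 (ltW M1).
Qed.

Lemma based_free x g h : based_homotopic x g h -> free_homotopic g h.
Proof. by move=> [H Hgh Hb]; exists H => // s hs; exists x => t; exact: Hb. Qed.

Lemma free_homotopic_sym g h : free_homotopic g h -> free_homotopic h g.
Proof.
move=> [H [cH H0 H1] Hb]; exists (H \o (fun st => (1 - st.1, st.2))); last first.
  by move=> s hs /=; apply: Hb; lra.
split.
- apply: within_comp cH; first by apply: continuous_subspaceT; continuity.
  by move=> [s t] [/= hs dt]; split => //=; move: hs; rewrite !in_itv /=; lra.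
- by move=> t dt /=; rewrite subr0 H1.
- by move=> t dt /=; rewrite subrr H0.
Qed.

Lemma free_homotopic_trans h g l :
  free_homotopic g h -> free_homotopic h l -> free_homotopic g l.
Proof.
move=> [H [cH H0 H1] Hb] [K [cK K0 K1] Kb].
exists (fun st => if st.1 <= 2^-1 then (H \o (fun st => (2 * st.1, st.2))) st
                  else (K \o (fun st => (2 * st.1 - 1, st.2))) st); last first.
  by move=> s hs /=; case: leP => h2; [apply: Hb|apply: Kb]; lra.
split => /=.
- apply: (within_if (D := slab) (c := fst)).
  + exact: closed_slab.
  + by continuity.
  + apply: within_comp cH; first by apply: continuous_subspaceT; continuity.
    move=> [s t] [[/= hs dt] s2]; split => //=.
    by move: hs s2; rewrite !in_itv /=; lra.
  + apply: within_comp cK; first by apply: continuous_subspaceT; continuity.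
    move=> [s t] [[/= hs dt] s2]; split => //=.
    by move: hs s2; rewrite !in_itv /=; lra.
  + move=> [s t] [_ /= dt] ->.
    by rewrite mulfV // subrr H1 // K0.
- by move=> t dt; rewrite ifT ?mulr0 ?H0 //; lra.
- move=> t dt; rewrite ifF; last by apply/negbTE; rewrite -ltNge; lra.
  by have -> : 2 * 1 - 1 = 1 :> R; [lra|exact: K1].
Qed.

Lemma null_free_homotopic g h : free_homotopic g h -> null h -> null g.
Proof. by move=> gh [x hx]; exists x; exact: free_homotopic_trans gh hx. Qed.

Hypothesis k0 : (0 < k)%N.

(** The map [(s, t) |-> (1 - s) *: wrap t] presents the ball of [R * 'rV_k] as
    a quotient of the slab. Two points are identified when [s = 1], or when
    they lie on the boundary of the ball at the same [s]; a free homotopy to a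
    constant takes equal values at such points. *)
Lemma null_extends g : null g -> exists2 psi : R * V -> X,
  {within disk, continuous psi} & forall t, disk t -> psi (wrap t) = g t.
Proof.
move=> [x [H [cH H0 H1] Hb]].
pose q (st : R * V) : R * V := (1 - st.1) *: wrap st.2.
pose psi p := H (xget (0, 0) [set st | slab st /\ q st = p]).
have cq : continuous q.
  apply: fun_continuousZ; first by continuity.
  apply: (@continuous_comp_fun _ _ _ snd wrap); [continuity|exact: wrap_continuous].
have psiq st : slab st -> psi (q st) = H st.
  case: st => s t st; rewrite /psi; case: xgetP => [[s' t'] _ /= [st' qE]|]; last first.
    by move=> /(_ (s, t)) /=; case.
  move: st st'; rewrite /slab /setX /= !in_itv /= => -[s01 dt] [s01' dt'].
  have ss' : s' = s.
    have := congr1 Num.norm qE; rewrite /q /= [LHS]normrZ [RHS]normrZ !wrap_norm !mulr1.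
    by rewrite !ger0_norm ?subr_ge0; lra.
  move: qE; rewrite ss' /q /=; have [->|s1] := eqVneq s 1.
    by rewrite !H1.
  have s1' : 1 - s != 0 by rewrite subr_eq0 eq_sym.
  move=> /(scalerI s1') /(wrap_inj dt' dt) [->//|[bt' bt]].
  by have [y Hy] := Hb s s01; rewrite !Hy.
exists psi; last first.
  move=> t dt; rewrite -H0 // -psiq; last by split => //=; rewrite in_itv /=; lra.
  by rewrite /q /= subr0 scale1r.
suff -> : disk = q @` slab.
  apply: (quotient_continuous (h := H)) => //.
  - exact: compact_slab.
  - exact: continuous_subspaceT.
apply/seteqP; split => [p p1|_ [[s t] [/= s01 dt] <-]]; last first.
  rewrite /disk /q /= normrZ wrap_norm mulr1.
  by move: s01; rewrite in_itv /= => s01; rewrite ger0_norm; lra.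
have [p0|p0] := eqVneq p 0.
  exists (1, 0); last by rewrite /q /= subrr scale0r p0.
  by split => /=; rewrite ?in_itv /= ?ler01 ?lexx // /disk /= normr0.
have np0 : 0 < `|p| by rewrite normr_gt0.
have [t dt tp] : exists2 t, disk t & wrap t = `|p|^-1 *: p.
  by apply: wrap_surj => //; rewrite /sphere /= normrZ normfV normr_id mulVf // lt0r_neq0.
exists (1 - `|p|, t); last first.
  by rewrite /q /= tp opprB addrC subrK scalerA mulfV ?scale1r // lt0r_neq0.
by split => //=; rewrite in_itv /=; move: p1; rewrite /disk /=; lra.
Qed.

(** An extension to the ball yields a homotopy that fixes the base point:
    contract the ball linearly to the south pole. *)
Lemma null_based g x : (forall t, sphere t -> g t = x) -> null g ->
  based_homotopic x g (fun=> x).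
Proof.
move=> gx /null_extends[psi cpsi psig].
exists (psi \o (fun st => (1 - st.1) *: wrap st.2 + st.1 *: (-1, 0))); last first.
  move=> s t hs bt /=; rewrite wrap_boundary // -scalerDl subrK scale1r.
  rewrite -(wrap_boundary bt) psig; first exact: gx.
  by rewrite /disk /= bt.
split.
- apply: within_comp cpsi.
    apply: continuous_subspaceT; continuity.
    by apply: (@continuous_comp_fun _ _ _ snd wrap); [continuity|exact: wrap_continuous].
  move=> [s t] [/= hs dt]; rewrite /disk /=.
  apply: le_trans (ler_normD _ _) _.
  rewrite [X in X + _]normrZ [X in _ + X]normrZ wrap_norm.
  rewrite prod_normE /= normrN normr1 normr0 max_l // !mulr1.
  by move: hs; rewrite in_itv /= => hs; rewrite !ger0_norm; lra.
- by move=> t dt /=; rewrite subr0 scale0r addr0 scale1r psig.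
- move=> t dt /=; rewrite subrr scale0r add0r scale1r.
  have [t1 bt1] : exists t1 : V, sphere t1.
    by exists (const_mx 1); exact: norm_const_mx1.
  by rewrite -(wrap_boundary bt1) psig ?gx // /disk /= bt1.
Qed.

Lemma null_fills (phi : R * V -> X) : null (phi \o wrap) -> exists2 psi : R * V -> X,
  {within disk, continuous psi} & forall p, sphere p -> psi p = phi p.
Proof.
move=> /null_extends[psi cpsi psiE]; exists psi => // p bp.
by have [t dt <-] := wrap_surj k0 bp; exact: psiE.
Qed.

Definition pointed_map g x :=
  {within disk, continuous g} /\ forall t, sphere t -> g t = x.

(** At stage [s] the map is squeezed into the ball of radius [1 / (1 + s)],
    and the shell around it follows the path up to time [s]. *)
Lemma move_basepoint g x z (c : R -> X) : pointed_map g x ->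
  {within `[0, 1]%classic, continuous c} -> c 0 = x -> c 1 = z ->
  exists2 g', pointed_map g' z & free_homotopic g g'.
Proof.
move=> [cg gx] cc c0 c1.
pose r (st : R * V) := (1 + st.1) * `|st.2|.
pose G st := if r st <= 1 then (g \o (fun st => (1 + st.1) *: st.2)) st
             else (c \o (fun st => r st - 1)) st.
have nr (s : R) t : 0 <= s <= 1 -> `|(1 + s) *: t| = r (s, t).
  by move=> hs; rewrite normrZ ger0_norm //; lra.
have cr : continuous r by rewrite /r; continuity.
have cG : {within slab, continuous G}.
  apply: within_if => //.
  - exact: closed_slab.
  - apply: within_comp cg; first by apply: continuous_subspaceT; continuity.
    by move=> [s t] [[/= hs dt] s2]; rewrite /disk /= nr.
  - apply: within_comp cc.
      by apply: continuous_subspaceT; apply: fun_continuousB => //; exact: cst_continuous.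
    move=> [s t] [[/= hs dt] s2]; rewrite in_itv /= subr_ge0 s2 /=.
    move: hs dt s2; rewrite in_itv /disk /r /= => hs dt s2; nra.
  - move=> [s t] [/= hs dt] rst; by rewrite rst subrr c0 gx // /sphere /= nr.
have G1 (s : R) t : 0 <= s <= 1 -> sphere t -> G (s, t) = c s.
  move=> hs bt; rewrite /G /r /= bt mulr1; case: leP => s1.
    have s0 : s = 0 by lra.
    by rewrite s0 c0 addr0 scale1r gx.
  by rewrite (addrC 1) addrK.
exists (fun t => G (1, t)).
  split; last by move=> t bt; rewrite G1 ?c1 //; lra.
  apply: (within_comp (f := fun t : V => (1 : R, t))) cG.
    by apply: continuous_subspaceT; continuity.
  by move=> t dt; split => //=; rewrite in_itv /=; lra.
exists G; last by move=> s hs; exists (c s) => t; exact: G1.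
split => // t dt; rewrite /G /r /= addr0 mul1r scale1r ifT //.
Qed.

End FreeHomotopy.

(** * Spheroids on the cube and on the ball *)

Section SpheroidsAsMaps.
Context {R : realType} {X : topologicalType} {k : nat} (x : X).
Local Notation V := 'rV[R]_k.
Implicit Types (s : spheroid R x k).

(** The unit ball for the sup norm is the cube with coordinates in [[-1, 1]],
    hence an affine copy of the unit cube on which spheroids are defined. *)
Definition to_cube (t : V) : V := \row_i ((t 0 i + 1) / 2).
Definition to_disk (t : V) : V := \row_i (2 * t 0 i - 1).

Lemma to_diskK : cancel to_disk to_cube.
Proof. by move=> t; apply/rowP => i; rewrite !mxE; field. Qed.

Lemma to_cubeK : cancel to_cube to_disk.
Proof. by move=> t; apply/rowP => i; rewrite !mxE; field. Qed.

Lemma coord_norm_le (t : V) i : `|t 0 i| <= `|t|.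
Proof. exact: mx_entry_norm. Qed.

Lemma sphere_coord (t : V) : sphere t -> exists i, `|t 0 i| = 1.
Proof.
move=> t1; have : mx_norm t != 0 by rewrite -[mx_norm t]/(`|t|) t1 oner_eq0.
move=> /mx_norm_neq0 [[i j] /= E]; exists j; rewrite -(ord1 i) -E.
exact: t1.
Qed.

Lemma to_cube_disk t : disk t -> unit_cube (to_cube t).
Proof.
move=> t1 i; rewrite mxE; have := le_trans (coord_norm_le t i) t1.
by rewrite ler_norml; lra.
Qed.

Lemma to_disk_cube t : unit_cube t -> disk (to_disk t).
Proof.
move=> ht; apply: rV_norm_le => // i; rewrite mxE ler_norml.
by have := ht i; lra.
Qed.

Lemma to_cube_sphere t : sphere t -> cube_boundary (to_cube t).
Proof.
move=> bt; split; first by apply: to_cube_disk; rewrite /disk /= bt.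
have [i ti] := sphere_coord bt; exists i; rewrite mxE.
by case: (ger0P (t 0 i)) ti => _ ti; [right|left]; lra.
Qed.

Lemma to_disk_boundary t : cube_boundary t -> sphere (to_disk t).
Proof.
move=> [ht [i ti]]; apply/le_anti/andP; split; first exact: to_disk_cube.
apply: le_trans (coord_norm_le _ i); rewrite mxE.
by case: ti => ->; rewrite ?mulr0 ?sub0r ?normrN ?normr1 // ger0_norm; lra.
Qed.

Lemma to_cube_continuous : continuous to_cube.
Proof.
apply: continuous_rV => i.
have -> : (fun t => to_cube t 0 i) = (fun t => (t 0 i + 1) / 2).
  by apply/funext => t; rewrite mxE.
have ci : continuous (fun t : V => t 0 i) by move=> t; exact: coord_continuous.
by continuity.
Qed.

Lemma to_disk_continuous : continuous to_disk.
Proof.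
apply: continuous_rV => i.
have -> : (fun t => to_disk t 0 i) = (fun t => 2 * t 0 i - 1).
  by apply/funext => t; rewrite mxE.
have ci : continuous (fun t : V => t 0 i) by move=> t; exact: coord_continuous.
by continuity.
Qed.

Lemma based_spheroid s s' : homotopic_rel s s' ->
  based_homotopic x (s \o to_cube) (s' \o to_cube).
Proof.
move=> [H [cH H0 H1 Hb]].
exists (H \o (fun st => (st.1, to_cube st.2))); last first.
  by move=> r t hr bt; apply: Hb => //; exact: to_cube_sphere.
split.
- apply: within_comp cH.
    apply: continuous_subspaceT; continuity.
    by apply: (@continuous_comp_fun _ _ _ snd to_cube); [continuity|exact: to_cube_continuous].
  by move=> [r t] [/= hr dt]; split => //; exact: to_cube_disk.
- by move=> t dt; apply: H0; exact: to_cube_disk.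
- by move=> t dt; apply: H1; exact: to_cube_disk.
Qed.

Lemma spheroid_based s s' : based_homotopic x (s \o to_cube) (s' \o to_cube) ->
  homotopic_rel s s'.
Proof.
move=> [H [cH H0 H1] Hb].
exists (H \o (fun st => (st.1, to_disk st.2))); split.
- apply: within_comp cH.
    apply: continuous_subspaceT; continuity.
    by apply: (@continuous_comp_fun _ _ _ snd to_disk); [continuity|exact: to_disk_continuous].
  by move=> [r t] [/= hr dt]; split => //; exact: to_disk_cube.
- by move=> t dt; rewrite /= H0 /= ?to_diskK //; exact: to_disk_cube.
- by move=> t dt; rewrite /= H1 /= ?to_diskK //; exact: to_disk_cube.
- by move=> r t hr bt; apply: Hb => //; exact: to_disk_boundary.
Qed.

Lemma pointed_map_spheroid g : pointed_map g x ->
  exists s, forall t, s (to_cube t) = g t.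
Proof.
move=> [cg gx].
have cs : {within unit_cube (k := k), continuous (g \o to_disk)}.
  apply: within_comp cg; first exact: continuous_subspaceT to_disk_continuous.
  exact: to_disk_cube.
have bs t : cube_boundary t -> (g \o to_disk) t = x.
  by move=> bt; apply: gx; exact: to_disk_boundary.
by exists (Spheroid cs bs) => t /=; rewrite to_cubeK.
Qed.

End SpheroidsAsMaps.

(** * Maps injective on homotopy groups *)

Section InducedMapInjective.
Context {R : realType} {X : topologicalType}.

Lemma free_homotopic_comp k (F : X -> X) (g h : 'rV[R]_k -> X) : continuous F ->
  free_homotopic g h -> free_homotopic (F \o g) (F \o h).
Proof.
move=> cF [H [cH H0 H1] Hb]; exists (F \o H).
  split.
  - apply: (within_comp (B := [set: X]) cH) => //.
    exact: continuous_subspaceT.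
  - by move=> t dt /=; rewrite H0.
  - by move=> t dt /=; rewrite H1.
by move=> s hs; have [y Hy] := Hb s hs; exists (F y) => t bt /=; rewrite Hy.
Qed.

Definition path_joined (x y : X) := exists c : R -> X,
  [/\ {within `[0, 1]%classic, continuous c}, c 0 = x & c 1 = y].

Variables (F : X -> X) (cF : continuous F) (z : X).
Hypothesis pathX : forall x y, path_joined x y.
Hypothesis injF : forall k, injective (pi_map R cF z k.+1).

Lemma pointed_map_comp k (g : 'rV[R]_k -> X) x :
  pointed_map g x -> pointed_map (F \o g) (F x).
Proof.
move=> [cg gx]; split; last by move=> t bt /=; rewrite gx.
apply: (within_comp (B := [set: X]) cg) => //; exact: continuous_subspaceT.
Qed.

(** The base point of [g] is dragged to [z], where the induced map is
    injective; the free null-homotopy of the image is first turned into a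
    based one, since only based homotopies define elements of the homotopy
    group. *)
Lemma null_of_image k (g : 'rV[R]_k.+1 -> X) x :
  pointed_map g x -> null (F \o g) -> null g.
Proof.
move=> gx nFg; have [c [cc c0 c1]] := pathX x z.
have [g' g'z gg'] := move_basepoint gx cc c0 c1.
apply: (null_free_homotopic gg').
have nFg' : null (F \o g').
  apply: null_free_homotopic nFg; apply: free_homotopic_comp => //.
  exact: free_homotopic_sym.
have [s sE] := pointed_map_spheroid g'z.
have sg' : s \o to_cube = g' by apply/funext.
have hFs : homotopic_rel (compose_spheroid cF s) (const_spheroid (F z) k).
  apply: spheroid_based; rewrite /= -/(F \o s) -compA sg'.
  apply: null_based => //; exact: (pointed_map_comp g'z).2.
have : pi_map R cF z k.+1 (homotopy_class s) =
       pi_map R cF z k.+1 (homotopy_class (const_spheroid z k)).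
  rewrite !pi_mapE; transitivity (homotopy_class (const_spheroid (R := R) (F z) k)).
    exact/homotopy_classP.
  by apply/homotopy_classP; exact: homotopic_rel_eq.
move=> /injF /homotopy_classP /based_spheroid; rewrite sg' => h.
by exists z; exact: based_free h.
Qed.

Lemma null_of_iter k N (g : 'rV[R]_k.+1 -> X) x :
  pointed_map g x -> null (iter N F \o g) -> null g.
Proof.
move=> gx; suff : pointed_map (iter N F \o g) (iter N F x) /\
    (null (iter N F \o g) -> null g) by case.
elim: N => [|N [IH1 IH2]]; first by [].
split; first exact: (pointed_map_comp IH1).
by move=> nN; apply: IH2; exact: (null_of_image IH1).
Qed.

End InducedMapInjective.

(** * An open set as a topological space *)

Section OpenSubset.
Context {R : realType} {n : nat}.
Local Notation V := 'rV[Cplx R]_n.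

Lemma real_complex_continuous : continuous (fun s : R => s%:C%C : Cplx R).
Proof.
move=> s; apply/cvgrPdist_lt => e e0.
have eE : e = (complex.Re e)%:C%C :> R[i].
  by apply/esym/RRe_real; exact: gtr0_real.
have e0' : 0 < complex.Re e by rewrite -ltcR -eE.
exists (complex.Re e) => // t /= st.
by rewrite -(rmorphB (real_complex R)) eE normcE ltcR cabs_real.
Qed.

Definition segment (a b : V) (s : R) : V := (1 - s)%:C%C *: a + s%:C%C *: b.

Lemma segment0 a b : segment a b 0 = a.
Proof. by rewrite /segment subr0 scale1r scale0r addr0. Qed.

Lemma segment1 a b : segment a b 1 = b.
Proof. by rewrite /segment subrr scale1r scale0r add0r. Qed.

Lemma segment_ball (p a b : V) (r : Cplx R) (s : R) : 0 <= s <= 1 ->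
  ball p r a -> ball p r b -> ball p r (segment a b s).
Proof.
move=> /andP[s0 s1] [r0 pa] [_ pb]; split => // i j.
have := pa i j; have := pb i j; rewrite -!ball_normE /= => pbij paij.
rewrite !mxE.
have -> : p i j - ((1 - s)%:C%C * a i j + s%:C%C * b i j) =
   (1 - s)%:C%C * (p i j - a i j) + s%:C%C * (p i j - b i j).
  by rewrite rmorphB /=; ring.
apply: le_lt_trans (ler_normD _ _) _; rewrite !normrM.
have ns : `|s%:C%C : Cplx R| = s%:C%C by rewrite ger0_norm // lecR.
have ns' : `|(1 - s)%:C%C : Cplx R| = (1 - s)%:C%C.
  by rewrite ger0_norm // lecR subr_ge0.
rewrite ns ns'; have -> : r = (1 - s)%:C%C * r + s%:C%C * r.
  by rewrite rmorphB /=; ring.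
have [->|sn] := eqVneq s 1.
  by rewrite subrr !mul0r !add0r !mul1r.
apply: ltr_leD.
  by rewrite ltr_pM2l // ltcR subr_gt0 lt_neqAle sn.
by apply: ler_wpM2l; [rewrite lecR|exact: ltW].
Qed.

Lemma segment_continuous (T : topologicalType) (a : T -> V) (b : V) (s : T -> R) :
  continuous a -> continuous s -> continuous (fun x => segment (a x) b (s x)).
Proof.
move=> ca cs x; apply: cvgD; apply: cvgZ.
- apply: (@continuous_comp_fun _ _ _ (fun x => 1 - s x) (fun s : R => s%:C%C : Cplx R)).
    by continuity.
  exact: real_complex_continuous.
- exact: ca.
- apply: (@continuous_comp_fun _ _ _ s (fun s : R => s%:C%C : Cplx R)) => //.
  exact: real_complex_continuous.
- exact: cvg_cst.
Qed.

Variable U : set V.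
Hypothesis oU : open U.
Hypothesis cU : connected U.

(** Being joined by a path in [U] is an equivalence relation, and nearby
    points are joined by a segment inside a ball. *)
Lemma open_connected_paths (x y : V) : U x -> U y -> exists c : R -> V,
  [/\ {within `[0, 1]%classic, continuous c}, c 0 = x, c 1 = y &
      forall s, 0 <= s <= 1 -> U (c s)].
Proof.
apply: (connected_related (r := fun x y => exists c : R -> V,
  [/\ {within `[0, 1]%classic, continuous c}, c 0 = x, c 1 = y &
      forall s, 0 <= s <= 1 -> U (c s)])) => //.
- move=> {}x {}y [c [cc c0 c1 cU']]; exists (c \o (fun s => 1 - s)); split => /=.
  + apply: within_comp cc; first by apply: continuous_subspaceT; continuity.
    by move=> s; rewrite /= !in_itv /=; lra.
  + by rewrite subr0.
  + by rewrite subrr.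
  + by move=> s hs; apply: cU'; lra.
- move=> {}x {}y w [c [cc c0 c1 cU']] [d [cd d0 d1 dU]].
  exists (fun s => if s <= 2^-1 then (c \o (fun s => 2 * s)) s
                   else (d \o (fun s => 2 * s - 1)) s); split.
  + apply: (@within_if R R _ `[0, 1]%classic (fun s : R => s) 2^-1
      (c \o (fun s => 2 * s)) (d \o (fun s => 2 * s - 1))).
    * exact: interval_closed.
    * exact: fun_continuous_id.
    * apply: within_comp cc; first by apply: continuous_subspaceT; continuity.
      by move=> s [/=]; rewrite !in_itv /=; lra.
    * apply: within_comp cd; first by apply: continuous_subspaceT; continuity.
      by move=> s [/=]; rewrite !in_itv /=; lra.
    * by move=> s _ ->; rewrite /= mulfV // subrr c1.
  + by rewrite /= ifT ?mulr0 //; lra.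
  + rewrite /= ifF; last by apply/negbTE; rewrite -ltNge; lra.
    by have -> : 2 * 1 - 1 = 1 :> R by lra.
  + by move=> s hs /=; case: leP => s2; [apply: cU'|apply: dU]; lra.
- move=> {}x Ux; have /nbhs_ballP[e /= e0 xeU] := open_nbhs_nbhs (conj oU Ux).
  apply: filterS (nbhsx_ballx x _ e0) => {}y xy; exists (segment x y); split.
  + apply: continuous_subspaceT; apply: segment_continuous.
      exact: cst_continuous.
    exact: fun_continuous_id.
  + exact: segment0.
  + exact: segment1.
  + by move=> s hs; apply: xeU; apply: segment_ball => //; exact: ballxx.
Qed.

Variable u0 : U.

(** A total inverse of the inclusion of [U]; the value [u0] outside [U] is
    arbitrary. *)
Definition into (z : V) : U :=
  if pselect (U z) is left h then exist _ z (mem_set h) else u0.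

Lemma intoK z : U z -> set_val (into z) = z.
Proof. by move=> Uz; rewrite /into; case: pselect. Qed.

Lemma into_val (u : U) : into (set_val u) = u.
Proof. by apply: val_inj; exact: intoK (set_valP u). Qed.

Lemma into_continuous : {within U, continuous into}.
Proof.
apply/subspace_sigL_continuousP.
have -> : sigL U into = id by apply/funext => u; exact: into_val.
by move=> x; exact: cvg_id.
Qed.

Lemma val_continuous : continuous (set_val : U -> V).
Proof. exact: initial_continuous. Qed.

Lemma subset_path_joined (x y : U) : path_joined (R := R) x y.
Proof.
have [c [cc c0 c1 cU']] := open_connected_paths (set_valP x) (set_valP y).
exists (into \o c); split; rewrite /= ?c0 ?c1 ?into_val //.
by apply: within_comp cc _ into_continuous => s; rewrite /= in_itv; exact: cU'.
Qed.

(** The straight homotopy to the centre stays in the ball. *)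
Lemma small_image_null k (g : 'rV[R]_k -> U) x (p : V) (r : Cplx R) :
  pointed_map g x -> ball p r `<=` U ->
  (forall t, disk t -> ball p r (set_val (g t))) -> null g.
Proof.
move=> [cg gx] pU gp.
have p_in (t : 'rV[R]_k) : disk t -> ball p r p.
  by move=> /gp [r0 _]; exact: ballxx.
exists (into p), (into \o (fun st => segment (set_val (g st.2)) p st.1)).
  split.
  - apply: (within_comp (B := U)); last exact: into_continuous.
      apply: (within_comp (f := fun st : R * 'rV[R]_k => (st.1, set_val (g st.2)))
        (B := [set: R * V]) (g := fun sv => segment sv.2 p sv.1)) => //.
        have cg2 : {within slab, continuous (fun st : R * 'rV[R]_k => set_val (g st.2))}.
          apply: (within_comp (f := fun st : R * 'rV[R]_k => g st.2) (B := [set: U])) => //.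
            apply: within_comp cg; first by apply: continuous_subspaceT; continuity.
            by move=> st [].
          by apply: continuous_subspaceT; exact: val_continuous.
        have cg1 : {within slab, continuous (fun st : R * 'rV[R]_k => st.1)}.
          by apply: continuous_subspaceT; continuity.
        exact: (@continuous_pair (subspace slab) _ _ _ _ cg1 cg2).
      apply: continuous_subspaceT; apply: segment_continuous; continuity.
    move=> [s t] [/= hs dt]; apply: pU; apply: segment_ball; last exact: p_in dt.
      by move: hs; rewrite in_itv.
    exact: gp.
  - by move=> t dt /=; rewrite segment0 into_val.
  - by move=> t dt /=; rewrite segment1.
by move=> s hs; exists (into (segment (set_val x) p s)) => t bt /=; rewrite gx.
Qed.

End OpenSubset.

(** * Filling spheres *)

Section Fills.
Context {R : realType} (X : topologicalType).

(** Vanishing of the homotopy group of degree [k], free of base points. The ball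
    is taken in [R * 'rV_k] because the cells to be filled are prisms. *)
Definition fills k := forall phi : R * 'rV[R]_k -> X,
  {within sphere, continuous phi} -> exists2 psi : R * 'rV[R]_k -> X,
    {within disk, continuous psi} & forall p, sphere p -> psi p = phi p.

(** In degree 0 the sphere is a pair of points, to be joined by a path. In
    higher degrees [phi \o wrap] is a spheroid, and a free null-homotopy of it
    extends [phi]. *)
Lemma fills_of_null : (forall x y : X, path_joined (R := R) x y) ->
  (forall k (g : 'rV[R]_k.+1 -> X) x, pointed_map g x -> null g) -> forall k, fills k.
Proof.
move=> pathX nullX [|k] phi cphi; last first.
  apply: null_fills => //; apply: (nullX _ _ (phi (-1, 0))); split.
    apply: within_comp cphi; first exact: continuous_subspaceT wrap_continuous.
    by move=> t _; exact: wrap_norm.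
  by move=> t bt /=; rewrite wrap_boundary.
have [c [cc c0 c1]] := pathX (phi (-1, 0)) (phi (1, 0)).
have n0 (v : 'rV[R]_0) : v = 0 by apply/rowP => -[].
exists (c \o (fun p => (p.1 + 1) / 2)).
  apply: within_comp cc; first by apply: continuous_subspaceT; continuity.
  move=> [s v]; rewrite /disk /= (n0 v) prod_normE /= normr0 max_l //.
  by rewrite ler_norml in_itv /=; lra.
move=> [s v]; rewrite /sphere /= (n0 v) prod_normE /= normr0 max_l //.
case: (ger0P s) => _ s1; first by rewrite s1 (_ : (1 + 1) / 2 = 1) ?c1 //; lra.
have -> : s = -1 by lra.
by rewrite addNr mul0r c0.
Qed.

End Fills.

(** * Cells of a cubical grid *)

Section GridCells.
Context {R : realType} {M : nat}.
Local Notation V := 'rV[R]_M.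
Local Notation code := {ffun 'I_M -> int * bool}.
Implicit Types (N : R) (e : code) (x y : V) (c d : int * bool).

(** [(m, false)] codes the point [m] of the line and [(m, true)] the interval
    from [m] to [m + 1]. *)
Definition lo c : int := c.1.
Definition hi c : int := c.1 + Posz c.2.

Definition cell N e : set V :=
  [set x | forall i, (lo (e i))%:~R <= N * x 0 i <= (hi (e i))%:~R].

Definition locate1 (u : R) : int * bool := (Num.floor u, (Num.floor u)%:~R < u).

Definition locate N x : code := [ffun i => locate1 (N * x 0 i)].

Definition face e e' := forall i, (lo (e' i) <= lo (e i)) && (hi (e i) <= hi (e' i)).

Definition cell_dim e := #|[set i | (e i).2]%SET|.

Lemma hi_locate1 u : hi (locate1 u) = Num.ceil u.
Proof.
rewrite /hi /= ceil_floor; congr (_ + _); rewrite intrEfloor.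
by rewrite lt_neqAle floor_le andbT; case: (_ == u).
Qed.

(** Floor and ceiling reduce inclusions of cells to inequalities between
    integers. *)
Lemma cell_face N e x : cell N e x <-> face (locate N x) e.
Proof.
split=> H i; have := H i; rewrite ffunE hi_locate1 /lo /=.
  by rewrite floor_ge_int ceil_le_int.
by rewrite floor_ge_int ceil_le_int.
Qed.

Lemma face_refl e : face e e.
Proof. by move=> i; rewrite !lexx. Qed.

Lemma face_trans e1 e2 e3 : face e1 e2 -> face e2 e3 -> face e1 e3.
Proof.
move=> H K i; have /andP[h1 h2] := H i; have /andP[k1 k2] := K i.
by rewrite (le_trans k1) // (le_trans h2).
Qed.

Lemma locate_cell N x : cell N (locate N x) x.
Proof. by apply/cell_face; exact: face_refl. Qed.

Lemma face_cell N e e' : face e e' -> cell N e `<=` cell N e'.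
Proof. by move=> ee' x /cell_face xe; apply/cell_face; exact: face_trans ee'. Qed.

Lemma face1 c d : (lo d <= lo c) && (hi c <= hi d) -> c = d \/ c.2 = false /\ d.2 = true.
Proof.
case: c d => [m [|]] [m' [|]]; rewrite /lo /hi /= => H; [left|lia|by right|left];
  by congr pair; lia.
Qed.

Lemma face_dim e e' : face e e' -> e = e' \/ (cell_dim e < cell_dim e')%N.
Proof.
move=> H; have [->|ne] := eqVneq e e'; [by left|right].
have sub : [set i | (e i).2]%SET \subset [set i | (e' i).2]%SET.
  apply/fintype.subsetP => i; rewrite !inE; have [->//|[-> //]] := face1 (H i).
apply: proper_card; rewrite properE sub /=; apply: contra ne => /fintype.subsetP sub'.
apply/eqP/ffunP => i; have [//|[ei ei']] := face1 (H i).
by have := sub' i; rewrite !inE ei ei' => /(_ isT).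
Qed.

Lemma closed_cell N e : closed (cell N e).
Proof.
have -> : cell N e = \bigcap_(i in [set: 'I_M])
    ((fun x => N * x 0 i) @^-1` `[(lo (e i))%:~R, (hi (e i))%:~R]%classic).
  by apply/seteqP; split => x /= H i; rewrite ?in_itv /=; [move=> _; exact: H|exact: H].
apply: closed_bigI => i _; apply: closed_comp; last exact: interval_closed.
move=> x _; apply: fun_continuousM; first exact: cst_continuous.
by move=> y; exact: coord_continuous.
Qed.

(** The subdivision with half the mesh is finer. *)
Lemma refine_cell N x y : cell (2 * N) (locate (2 * N) x) y -> cell N (locate N x) y.
Proof.
move=> H i; have /andP[] := H i; rewrite !ffunE /lo !hi_locate1 /= => H1 H2.
apply/andP; split.
  have : (2 * Num.floor (N * x 0 i))%:~R <= 2 * N * y 0 i.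
    apply: le_trans H1; rewrite ler_int floor_ge_int -mulrA rmorphM /=.
    by rewrite ler_pM2l // floor_le.
  by rewrite -mulrA rmorphM /= ler_pM2l.
have : 2 * N * y 0 i <= (2 * Num.ceil (N * x 0 i))%:~R.
  apply: (le_trans H2); rewrite ler_int ceil_le_int -mulrA rmorphM /=.
  by rewrite ler_pM2l // ceil_ge.
by rewrite -mulrA rmorphM /= ler_pM2l.
Qed.

Lemma cell_width N e x y i : cell N e x -> cell N e y -> `|N * x 0 i - N * y 0 i| <= 1.
Proof.
move=> /(_ i) + /(_ i); have : (hi (e i))%:~R <= (lo (e i))%:~R + 1 :> R.
  by rewrite -(intrD R _ 1) ler_int /hi /lo; case: (e i) => m [] /=; lia.
by rewrite ler_norml; lra.
Qed.

Section Parametrization.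
Variables (N : R) (e : code).
Hypothesis N0 : 0 < N.
Let S := [set i | (e i).2]%SET.
Let d := #|S|.
Local Notation W := 'rV[R]_d.

(** With [cell_point], identifies a cell with the ball of its own dimension. *)
Definition cell_coord (x : V) : W :=
  \row_j (2 * (N * x 0 (enum_val j) - (lo (e (enum_val j)))%:~R) - 1).

Definition cell_point (t : W) : V := \row_i
  (N^-1 * ((lo (e i))%:~R +
    if [pick j | enum_val j == i] is Some j then (t 0 j + 1) / 2 else 0)).

Let pick_odd (i : 'I_M) : (e i).2 ->
  exists2 j : 'I_d, [pick j | enum_val j == i] = Some j & enum_val j = i.
Proof.
move=> ei; case: pickP => [j /eqP ji|/(_ _)]; first by exists j.
have iS : i \in S by rewrite inE.
by move=> /(_ (enum_rank_in iS i)); rewrite enum_rankK_in // eqxx.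
Qed.

Let pick_even (i : 'I_M) : ~~ (e i).2 -> [pick j : 'I_d | enum_val j == i] = None.
Proof.
move=> ei; case: pickP => // j /eqP ji.
by have := enum_valP j; rewrite ji inE (negbTE ei).
Qed.

Let enum_odd (j : 'I_d) : (e (enum_val j)).2.
Proof. by have := enum_valP j; rewrite inE. Qed.

Lemma cell_coordK x : cell N e x -> cell_point (cell_coord x) = x.
Proof.
move=> ex; apply/rowP => i; rewrite mxE.
have [ei|ei] := boolP (e i).2.
  by have [j -> ji] := pick_odd ei; rewrite mxE ji; field; exact: lt0r_neq0.
rewrite pick_even // addr0; have := ex i; rewrite /hi (negbTE ei) addr0 -/(lo _) => H.
have -> : (lo (e i))%:~R = N * x 0 i by lra.
by rewrite mulrA mulVf ?mul1r // lt0r_neq0.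
Qed.

Lemma cell_coord_disk x : cell N e x -> disk (cell_coord x).
Proof.
move=> ex; apply: rV_norm_le => // j; rewrite mxE.
have := ex (enum_val j); rewrite /hi (enum_odd j) -/(lo _) rmorphD /= ler_norml.
by lra.
Qed.

Lemma cell_point_cell t : disk t -> cell N e (cell_point t).
Proof.
move=> t1 i; rewrite mxE mulrA mulfV ?lt0r_neq0 // mul1r.
have [ei|ei] := boolP (e i).2.
  have [j -> ji] := pick_odd ei; rewrite /hi ei -/(lo _) rmorphD /=.
  have := le_trans (coord_norm_le t j) t1; rewrite ler_norml; lra.
by rewrite pick_even // addr0 /hi (negbTE ei) addr0 !lexx.
Qed.

Lemma cell_coord_sphere x : cell N e x -> locate N x <> e -> sphere (cell_coord x).
Proof.
move=> ex xe; apply/le_anti/andP; split; first exact: cell_coord_disk.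
have [i ei] : exists i, locate1 (N * x 0 i) <> e i.
  apply: contrapT => H; apply: xe; apply/ffunP => i; rewrite ffunE.
  by apply: contrapT => h; apply: H; exists i.
have := (cell_face N e x).1 ex i; rewrite ffunE => /face1[E| [p1 p2]]; first by case: ei.
have [j _ ji] := pick_odd p2.
apply: le_trans (coord_norm_le _ j); rewrite mxE ji.
have := ex i; rewrite /hi p2 -/(lo _) rmorphD /=.
have /eqP : (Num.floor (N * x 0 i))%:~R = N * x 0 i.
  by apply/le_anti; rewrite floor_le leNgt [_ < _]p1.
have [fe|fe] := eqVneq (Num.floor (N * x 0 i)) (lo (e i)).
  move=> /eqP fx; rewrite -fx fe subrr mulr0 sub0r normrN normr1; lra.
move=> /eqP fx /andP[h1 h2]; have h3 : (lo (e i) + 1)%:~R <= N * x 0 i.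
  by rewrite -fx ler_int lezD1 lt_neqAle eq_sym fe -(ler_int R) fx.
rewrite rmorphD /= in h3.
by rewrite ger0_norm; lra.
Qed.

Lemma cell_point_sphere t : sphere t -> locate N (cell_point t) <> e.
Proof.
move=> bt; have [j tj] := sphere_coord bt.
move=> /ffunP /(_ (enum_val j)); rewrite ffunE => E.
have o : (locate1 (N * cell_point t 0 (enum_val j))).2 by rewrite E; exact: enum_odd.
have fl : Num.floor (N * cell_point t 0 (enum_val j)) = lo (e (enum_val j)).
  by rewrite /lo -E.
have vE : N * cell_point t 0 (enum_val j) =
    (lo (e (enum_val j)))%:~R + (t 0 j + 1) / 2.
  rewrite mxE mulrA mulfV ?lt0r_neq0 // mul1r.
  by have [j' -> /enum_val_inj ->] := pick_odd (enum_odd j).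
move: o; rewrite /locate1 /= fl vE => o.
have := floorD1_gt (N * cell_point t 0 (enum_val j)).
rewrite fl vE rmorphD /=; move: tj; case: (ger0P (t 0 j)) => _ tj; lra.
Qed.

Lemma cell_coord_continuous : continuous cell_coord.
Proof.
apply: continuous_rV => j.
have -> : (fun x => cell_coord x 0 j) =
    (fun x : V => 2 * (N * x 0 (enum_val j) - (lo (e (enum_val j)))%:~R) - 1).
  by apply/funext => t; rewrite mxE.
have ci : continuous (fun t : V => t 0 (enum_val j)).
  by move=> t; exact: coord_continuous.
by continuity.
Qed.

Lemma cell_point_continuous : continuous cell_point.
Proof.
apply: continuous_rV => i.
case E : [pick j : 'I_d | enum_val j == i] => [j|].
  have -> : (fun t => cell_point t 0 i) =
      (fun t : W => N^-1 * ((lo (e i))%:~R + (t 0 j + 1) / 2)).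
    by apply/funext => t; rewrite mxE E.
  have ci : continuous (fun t : W => t 0 j) by move=> t; exact: coord_continuous.
  by continuity.
have -> : (fun t => cell_point t 0 i) = (fun t : W => N^-1 * ((lo (e i))%:~R + 0)).
  by apply/funext => t; rewrite mxE E.
exact: cst_continuous.
Qed.

End Parametrization.

End GridCells.

(** * Extending homotopies over cells *)

Section ExtendOverCells.
Context {R : realType} {M : nat} {X : topologicalType}.
Local Notation V := 'rV[R]_M.
Local Notation code := {ffun 'I_M -> int * bool}.
Hypothesis fillX : forall k, fills (R := R) X k.
Variables (W : set V) (a b : V -> X).
Hypothesis ca : {within W, continuous a}.
Hypothesis cb : {within W, continuous b}.
Implicit Types (A : set V) (G : R * V -> X) (N : R) (e : code) (l : seq code).

Definition prism A : set (R * V) := `[0, 1]%classic `*` A.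

Definition partial_homotopy A G :=
  [/\ closed A, A `<=` W, {within prism A, continuous G} &
      forall x, A x -> G (0, x) = a x /\ G (1, x) = b x].

(** [A] is a union of cells. In this form the property passes to finer grids,
    by [refine_cell]. *)
Definition saturated N A := forall x, A x -> cell N (locate N x) `<=` A.

Lemma closed_prism A : closed A -> closed (prism A).
Proof.
move=> cA; apply: closedI.
  by apply: closed_comp; [move=> x _; exact: cvg_fst|exact: interval_closed].
by apply: closed_comp cA => x _; exact: cvg_snd.
Qed.

Section OneCell.
Variables (N : R) (e : code) (A : set V) (G : R * V -> X).
Hypothesis N0 : 0 < N.
Hypothesis hG : partial_homotopy A G.
Hypothesis eW : cell N e `<=` W.
Hypothesis boundary_in : forall x, cell N e x -> locate N x <> e -> A x.
Hypothesis interior_out : forall x, A x -> locate N x <> e.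

Local Notation d := #|[set i | (e i).2]%SET|.

Let Q (p : R * V) : R * 'rV[R]_d := (2 * p.1 - 1, cell_coord N e p.2).
Let P (q : R * 'rV[R]_d) : R * V := ((q.1 + 1) / 2, @cell_point R M N e q.2).

Let bdry (p : R * V) : X :=
  if p.1 <= 0 then a p.2 else if 1 <= p.1 then b p.2 else G p.

Let QK p : cell N e p.2 -> P (Q p) = p.
Proof.
case: p => s x /= ex; rewrite /P /Q /= cell_coordK //.
by have -> : (2 * s - 1 + 1) / 2 = s by field.
Qed.

Let Q_continuous : continuous Q.
Proof.
rewrite /Q; continuity.
apply: (@continuous_comp_fun _ _ _ snd (cell_coord N e)); first by continuity.
exact: cell_coord_continuous.
Qed.

Let P_continuous : continuous P.
Proof.
rewrite /P; continuity.
apply: (@continuous_comp_fun _ _ _ snd (@cell_point R M N e)); first by continuity.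
exact: cell_point_continuous.
Qed.

Let Q_disk p : prism (cell N e) p -> disk (Q p).
Proof.
case: p => s x [/=]; rewrite in_itv /= => hs ex.
rewrite /disk /= prod_normE /= ge_max; apply/andP; split.
  by rewrite ler_norml; lra.
exact: cell_coord_disk.
Qed.

Let Q_sphere p : prism (cell N e) p -> p.1 = 0 \/ p.1 = 1 \/ A p.2 -> sphere (Q p).
Proof.
move=> hp h; apply/le_anti/andP; split; first exact: Q_disk.
case: p hp h => s x [/= hs ex] h; rewrite prod_normE /= le_max.
case: h => [->|[->|Ax]].
- by rewrite mulr0 sub0r normrN normr1 lexx.
- by rewrite ger0_norm; lra.
- have sp : `|cell_coord N e x| = 1 := cell_coord_sphere ex (interior_out Ax).
  by rewrite sp lexx orbT.
Qed.

Let bdryA p : 0 <= p.1 <= 1 -> A p.2 -> bdry p = G p.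
Proof.
have [_ _ _ Gends] := hG; case: p => s x /= /andP[s0 s1] Ax; rewrite /bdry /=.
have [le0|gt0] := leP s 0.
  by rewrite (le_anti (introT andP (conj le0 s0))) (Gends _ Ax).1.
by case: leP => // ge1; rewrite (le_anti (introT andP (conj s1 ge1))) (Gends _ Ax).2.
Qed.

Let bdry_continuous : {within sphere, continuous (bdry \o P)}.
Proof.
have [cA AW cG Gends] := hG.
pose D1 : set (R * 'rV[R]_d) := disk `&` [set q : R * 'rV[R]_d | q.1 = -1].
pose D2 : set (R * 'rV[R]_d) := disk `&` [set q : R * 'rV[R]_d | q.1 = 1].
pose D3 : set (R * 'rV[R]_d) := disk `&` [set q : R * 'rV[R]_d | `|q.2| = 1].
have disk2 q : disk q -> `|q.1| <= 1 /\ disk q.2.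
  by rewrite /disk /= prod_normE ge_max => /andP[].
have point2 q : disk q -> cell N e (P q).2.
  by move=> /disk2 [_ q2]; exact: cell_point_cell.
have closed_fst (u : R) : closed [set q : R * 'rV[R]_d | q.1 = u].
  have -> : [set q : R * 'rV[R]_d | q.1 = u] = fst @^-1` [set u] by [].
  by apply: closed_comp; [move=> q _; exact: cvg_fst|exact: closed_eq].
have cl3 : closed [set q : R * 'rV[R]_d | `|q.2| = 1].
  have -> : [set q : R * 'rV[R]_d | `|q.2| = 1] = (fun q => `|q.2|) @^-1` [set 1] by [].
  apply: closed_comp; last exact: closed_eq.
  by move=> q _; have : continuous (fun q : R * 'rV[R]_d => `|q.2|); [continuity|exact].
have c1 : {within D1, continuous (bdry \o P)}.
  apply: (@within_eq _ _ _ (a \o (fun q => (P q).2))).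
    by move=> q [_ /= q1]; rewrite /bdry /= q1 addNr mul0r lexx.
  apply: within_comp ca.
    by apply: continuous_subspaceT; apply: fun_continuous_snd.
  by move=> q [dq _]; apply: eW; exact: point2.
have c2 : {within D2, continuous (bdry \o P)}.
  apply: (@within_eq _ _ _ (b \o (fun q => (P q).2))).
    move=> q [_ /= q1]; rewrite /bdry /= q1.
    by have -> : (1 + 1) / 2 = 1 :> R; [lra|rewrite leNgt ltr01 lexx].
  apply: within_comp cb.
    by apply: continuous_subspaceT; apply: fun_continuous_snd.
  by move=> q [dq _]; apply: eW; exact: point2.
have c3 : {within D3, continuous (bdry \o P)}.
  have inA q : D3 q -> A (P q).2.
    move=> [dq q2]; apply: boundary_in; first exact: point2.
    exact: cell_point_sphere.
  apply: (@within_eq _ _ _ (G \o P)).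
    move=> q D3q; rewrite /= bdryA //; last exact: inA.
    by have [/disk2 [+ _] _] := D3q; rewrite /P /= ler_norml; lra.
  apply: within_comp cG; first exact: continuous_subspaceT.
  move=> q D3q; split; last exact: inA.
  have [/disk2 [+ _] _] := D3q; rewrite /= in_itv /= ler_norml; lra.
apply: (@continuous_subspaceW _ _ _ (D1 `|` D2 `|` D3)).
  move=> q; rewrite /sphere /= => q1.
  have dq : disk q by rewrite /disk /= q1.
  move: q1; rewrite prod_normE; case: leP => _ q1; first by right.
  left; move: q1; case: (ger0P q.1) => _ q1; [by right|left; split => //=; lra].
have clD1 : closed D1 by apply: closedI; [exact: closed_disk|exact: closed_fst].
have clD2 : closed D2 by apply: closedI; [exact: closed_disk|exact: closed_fst].
have clD3 : closed D3 by apply: closedI => //; exact: closed_disk.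
by apply: withinU_continuous => //; [exact: closedU|exact: withinU_continuous].
Qed.

(** Over the boundary of the prism on the cell the homotopy is prescribed: by
    [a] and [b] at the two ends, and by [G] over the boundary of the cell,
    which lies in [A]. The prism being a ball, it extends to the inside. *)
Lemma extend_over_cell : exists2 G', partial_homotopy (A `|` cell N e) G' &
  forall p, prism A p -> G' p = G p.
Proof.
have [cA AW cG Gends] := hG.
have [psi cpsi psiE] := fillX bdry_continuous.
pose G' p := if `[< A p.2 >] then G p else psi (Q p).
have G'A p : A p.2 -> G' p = G p by move=> Ap; rewrite /G' asboolT.
have G'e p : prism (cell N e) p -> G' p = psi (Q p).
  move=> ep; rewrite /G'; case: asboolP => // Ap.
  have sp : sphere (Q p) by apply: Q_sphere => //; right; right.
  rewrite psiE //= QK; last by case: ep.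
  by rewrite bdryA //; case: ep; rewrite /= in_itv.
exists G'; last by move=> p [_ Ap]; exact: G'A.
split.
- by apply: closedU => //; exact: closed_cell.
- by move=> x [/AW|/eW].
- have -> : prism (A `|` cell N e) = prism A `|` prism (cell N e).
    apply/seteqP; split => p /=.
      by move=> [h []]; [left|right].
    by move=> [] []; split => //; [left|right].
  apply: withinU_continuous.
  + exact: closed_prism.
  + by apply: closed_prism; exact: closed_cell.
  + by apply: within_eq cG => p [_ Ap]; rewrite G'A.
  + apply: (@within_eq _ _ _ (psi \o Q)); first by move=> p ep; rewrite G'e.
    by apply: within_comp cpsi; [exact: continuous_subspaceT|exact: Q_disk].
- move=> x; have [Ax _|nA [//|ex]] := pselect (A x).
    by rewrite !G'A //; exact: Gends.
  have e0 : prism (cell N e) (0, x) by split => //=; rewrite in_itv /= lexx ler01.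
  have e1 : prism (cell N e) (1, x) by split => //=; rewrite in_itv /= lexx ler01.
  rewrite !G'e // !psiE; last 2 first.
  + by apply: Q_sphere => //; right; left.
  + by apply: Q_sphere => //; left.
  by rewrite /= !QK // /bdry /= lexx leNgt ltr01 /= lexx.
Qed.

End OneCell.

Definition cells N l : set V := [set x | exists2 e, e \in l & cell N e x].

Definition face_closed l := forall e e', e \in l -> face e' e -> e' \in l.

Lemma max_dim_cell l : l != [::] -> exists2 e, e \in l &
  forall e', e' \in l -> (cell_dim e' <= cell_dim e)%N.
Proof.
elim: l => // e l IH _; have [->|/IH[e1 e1l H]] := eqVneq l [::].
  by exists e; rewrite ?mem_seq1 // => e'; rewrite inE => /eqP ->.
have [le|lt] := leqP (cell_dim e1) (cell_dim e).
  exists e; first exact: mem_head.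
  by move=> e'; rewrite inE => /predU1P[->//|/H /leq_trans]; apply.
exists e1; first by rewrite inE e1l orbT.
by move=> e'; rewrite inE => /predU1P[->|/H //]; exact: ltnW.
Qed.

Lemma saturated_cells N A l : saturated N A -> saturated N (A `|` cells N l).
Proof.
move=> sA x [/sA Ax y /Ax|[e el /cell_face xe] y]; first by left.
by move=> /(face_cell xe) ey; right; exists e.
Qed.

(** Induction on the number of cells. The cell treated last has maximal
    dimension, so that the remaining cells contain its proper faces and are
    still closed under taking faces. *)
Lemma extend_over_cells N A G l : 0 < N -> partial_homotopy A G -> saturated N A ->
  face_closed l -> (forall e, e \in l -> cell N e `<=` W) ->
  exists2 G', partial_homotopy (A `|` cells N l) G' & forall p, prism A p -> G' p = G p.
Proof.
move=> N0 hG sA; move: {2}(size l) (leqnn (size l)) => m.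
elim: m l => [|m IH] l lm fl lW.
  move: lm; rewrite leqn0 size_eq0 => /eqP ->; exists G => //.
  suff -> : A `|` cells N [::] = A by [].
  by apply/seteqP; split => x; [case=> // -[]|left].
have [->|/max_dim_cell[e el emax]] := eqVneq l [::].
  by apply: IH => //.
pose l' := [seq e' <- l | e' != e].
have l'm : (size l' <= m)%N.
  rewrite -ltnS; apply: leq_trans lm; rewrite size_filter.
  rewrite -(count_predC (fun e' => e' != e) l) -[X in (X < _)%N]addn0 ltn_add2l.
  by rewrite -has_count; apply/hasP; exists e => //=; rewrite eqxx.
have l'E e' : (e' \in l') = (e' != e) && (e' \in l) by rewrite mem_filter.
have fl' : face_closed l'.
  move=> e1 e2; rewrite !l'E => /andP[ne e1l] f21; rewrite (fl _ _ e1l f21) andbT.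
  apply: contraNN ne => /eqP e2E; rewrite e2E in f21.
  case: (face_dim f21) => [->//|lt]; have := emax _ e1l.
  by rewrite leqNgt lt.
have [G1 hG1 G1E] := IH l' l'm fl' (fun e' (h : e' \in l') =>
  lW e' (proj2 (andP (etrans (esym (l'E e')) h)))).
have AE : A `|` cells N l = A `|` cells N l' `|` cell N e.
  apply/seteqP; split => x.
    move=> [Ax|[e' e'l xe']]; first by left; left.
    have [ee|ne] := eqVneq e' e; first by right; rewrite -ee.
    by left; right; exists e' => //; rewrite l'E ne.
  move=> [[Ax|[e' ]]|xe]; [by left| |by right; exists e].
  by rewrite l'E => /andP[_ e'l] xe'; right; exists e'.
have sA1 : saturated N (A `|` cells N l') by exact: saturated_cells.
have [sub|nsub] := pselect (cell N e `<=` A `|` cells N l').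
  exists G1 => //; rewrite AE.
  suff -> : A `|` cells N l' `|` cell N e = A `|` cells N l' by [].
  by apply/seteqP; split => x; [case=> // /sub|left].
have [||G2 hG2 G2E] := extend_over_cell N0 hG1 (lW e el).
- move=> x /cell_face f ne; right; exists (locate N x); last exact: locate_cell.
  by rewrite l'E (fl _ _ el f) andbT; apply/eqP.
- by move=> x Ax xe; apply: nsub; rewrite -xe; exact: sA1.
exists G2; first by rewrite AE.
move=> p Ap; rewrite G2E ?G1E //.
by case: Ap => h Ap; split => //; left.
Qed.

End ExtendOverCells.

(** * Exhausting an open set by dyadic cells *)

Section Exhaustion.
Context {R : realType} {M : nat} {X : topologicalType}.
Local Notation V := 'rV[R]_M.
Local Notation code := {ffun 'I_M -> int * bool}.
Hypothesis fillX : forall k, fills (R := R) X k.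
Variables (W : set V) (a b : V -> X).
Hypothesis oW : open W.
Hypothesis ca : {within W, continuous a}.
Hypothesis cb : {within W, continuous b}.

Definition box_code B (f : {ffun 'I_M -> 'I_(B + B).+1 * bool}) : code :=
  [ffun i => (Posz (f i).1 - Posz B : int, (f i).2)].

Definition box_codes (B : nat) : seq code :=
  [seq e : code <- map (@box_code B) (enum {: {ffun 'I_M -> 'I_(B + B).+1 * bool}}) |
    [forall i, (- Posz B <= lo (e i)) && (hi (e i) <= Posz B)]].

Lemma box_codesP B (e : code) : reflect
  (forall i, - Posz B <= lo (e i) /\ hi (e i) <= Posz B) (e \in box_codes B).
Proof.
rewrite mem_filter; apply: (iffP andP) => [[/forallP H _] i|H].
  by have /andP[] := H i.
split; first by apply/forallP => i; have [-> ->] := H i.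
apply/mapP; exists [ffun i => (inord (absz (lo (e i) + Posz B)), (e i).2)].
  exact: mem_enum.
apply/ffunP => i; rewrite !ffunE /= inordK; last first.
  by have := H i; rewrite /lo /hi; case: (e i) => m [] /= []; lia.
have := H i; rewrite /lo /hi; case: (e i) => m o /= [H1 H2].
by congr pair; lia.
Qed.

(** The cells of mesh [2 ^- j] in [W] whose coordinates are at most [2 ^ j] in
    absolute value; in units of the mesh the bound is [4 ^ j]. *)
Definition level_codes j : seq code :=
  [seq e <- box_codes (4 ^ j) | `[< cell (2 ^+ j : R) e `<=` W >]].

Lemma level_codesP j (e : code) : e \in level_codes j <->
  cell (2 ^+ j : R) e `<=` W /\
  forall i, - Posz (4 ^ j) <= lo (e i) /\ hi (e i) <= Posz (4 ^ j).
Proof.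
rewrite /level_codes mem_filter; split=> [/andP[/asboolP ? /box_codesP ?]//|[? H]].
by apply/andP; split; [exact/asboolP|exact/box_codesP].
Qed.

Lemma level_codes_face j : face_closed (level_codes j).
Proof.
move=> e e' /level_codesP[eW eB] ff.
apply/level_codesP; split=> [x /(face_cell ff) /eW//|i].
 have /andP[h1 h2] := ff i; have [h3 h4] := eB i.
by split; [exact: le_trans h1|exact: le_trans h4].
Qed.

Lemma level_codes_near (x : V) : W x -> exists j, nbhs x (cells (2 ^+ j : R) (level_codes j)).
Proof.
move=> Wx; have /nbhs_ballP[d /= d0 xdW] := open_nbhs_nbhs (conj oW Wx).
have d2 : 0 < d / 2 by rewrite divr_gt0.
pose T := Num.max (2 / d + 1) (`|x| + d).
have [j jT] : exists j, T < 2 ^+ j.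
  have := @cvg_geometric R 1 2^-1; rewrite ger0_norm ?invr_ge0 // invf_lt1 // ltr1n.
  have T0 : 0 < T.
    by rewrite /T lt_max; apply/orP; left; rewrite ltr_wpDl // divr_ge0 // ltW.
  move=> /(_ isT) /cvgr_lt /(_ T^-1); rewrite invr_gt0 => /(_ T0) [j _ Hj].
  exists j; have := Hj j (leqnn _); rewrite /= /geometric /= mul1r exprVn.
  by rewrite ltf_pV2 ?posrE // exprn_gt0.
exists j; set N := (2 ^+ j : R) in jT *.
have N0 : 0 < N by rewrite exprn_gt0.
have NN : (4 ^ j)%N%:R = N * N by rewrite /N -exprMn natrX; congr (_ ^+ _); ring.
move: jT; rewrite gt_max => /andP[Nd Nx].
have Nd' : 1 < N * (d / 2).
  have : 2 / d < N by lra.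
  by rewrite ltr_pdivrMr //; lra.
apply: filterS (nbhsx_ballx x _ d2) => y xy.
have xy' : `|x - y| < d / 2 by move: xy; rewrite -ball_normE.
exists (locate N y); last exact: locate_cell.
apply/level_codesP; split=> [z zy|i].
  apply: xdW; rewrite (splitr d).
  apply: ball_triangle xy _; rewrite -ball_normE /=.
  apply: (@le_lt_trans _ _ N^-1).
    apply: rV_norm_le => [|i]; first by rewrite invr_ge0 ltW.
    rewrite !mxE -(ler_pM2l N0) mulfV ?lt0r_neq0 // -{1}(gtr0_norm N0) -normrM.
    by rewrite mulrBr; apply: cell_width zy; exact: locate_cell.
  by rewrite -(ltr_pM2l N0) mulfV // lt0r_neq0.
rewrite ffunE hi_locate1 /lo /=.
have yN : `|y 0 i| <= N.
  apply: le_trans (coord_norm_le y i) _; apply: ltW; apply: lt_trans Nx.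
  rewrite -[y](subrK x) addrC; apply: le_lt_trans (ler_normD _ _) _.
  by rewrite ltrD2l distrC; lra.
have yNN : `|N * y 0 i| <= N * N by rewrite normrM gtr0_norm // ler_pM2l.
move: yNN; rewrite ler_norml => /andP[h1 h2].
by rewrite floor_ge_int ceil_le_int rmorphN /= -[(Posz (4 ^ j))%:~R]/((4 ^ j)%N%:R) NN.
Qed.

(** The partial homotopies on the finite complexes of the successive levels
    extend one another, and their domains contain neighbourhoods of all points
    of [W], so their union is continuous. *)
Lemma homotopy_from_open : exists H : R * V -> X,
  [/\ {within prism W, continuous H}, forall x, W x -> H (0, x) = a x &
      forall x, W x -> H (1, x) = b x].
Proof.
pose T := {st : nat * (set V * (R * V -> X)) |
  partial_homotopy W a b st.2.1 st.2.2 /\ saturated (2 ^+ st.1 : R) st.2.1}.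
pose step (s t : T) := let: (j, (D, G)) := sval s in let: (j', (D', G')) := sval t in
  [/\ j' = j.+1, D' = D `|` cells (2 ^+ j) (level_codes j) &
      forall p, prism D p -> G' p = G p].
have next (s : T) : {t : T | step s t}.
  apply: cid; case: s => -[j [D G]] [/= hG sD].
  have N0 : 0 < 2 ^+ j :> R by rewrite exprn_gt0.
  have [|G' hG' G'E] := extend_over_cells fillX ca cb N0 hG sD (@level_codes_face j).
    by move=> e /level_codesP[].
  have sD' : saturated (2 ^+ j.+1 : R) (D `|` cells (2 ^+ j) (level_codes j)).
    move=> x Dx y; rewrite exprS => /refine_cell.
    exact: (saturated_cells (l := level_codes j) sD).
  by exists (exist _ (j.+1, (_, G')) (conj hG' sD')).
have h0 : partial_homotopy W a b set0 (fun p => a p.2) /\ saturated (2 ^+ 0 : R) (set0 : set V).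
  split=> //; split => //; first exact: closed0.
  by apply/subspace_continuousP => p [].
have [F [F0 FS]] := dependent_choice next (exist _ (0%N, (set0, fun p => a p.2)) h0).
pose D n := (sval (F n)).2.1; pose G n := (sval (F n)).2.2.
have goodF n : partial_homotopy W a b (D n) (G n) by have [] := svalP (F n).
have FE n : [/\ (sval (F n)).1 = n, D n.+1 = D n `|` cells (2 ^+ n) (level_codes n) &
    forall p, prism (D n) p -> G n.+1 p = G n p].
  have numF m : (sval (F m)).1 = m.
    elim: m => [|m IH]; first by rewrite F0.
    have := FS m; rewrite /step; move: IH.
    by case: (sval (F m)) => i [? ?] /= ->; case: (sval (F m.+1)) => i' [? ?] [/= ->].
  have := FS n; have := numF n; rewrite /step /D /G; split => //;
    move: H H0; case: (sval (F n)) => i [? ?] /= ->;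
    by case: (sval (F n.+1)) => i' [? ?] [].
have mono i j : (i <= j)%N -> D i `<=` D j /\ forall p, prism (D i) p -> G j p = G i p.
  move=> /subnKC <-; elim: (j - i)%N => [|m [IH1 IH2]].
    by rewrite addn0; split => // x.
  have [_ DE GE] := FE (i + m)%N; rewrite addnS; split.
    by rewrite DE => x /IH1; left.
  by move=> p ip; rewrite GE ?IH2 //; case: ip => ? /IH1.
have cover x : W x -> exists j, nbhs x (D j).
  move=> /level_codes_near[j xj]; exists j.+1; apply: filterS xj => y yj.
  by have [_ -> _] := FE j; right.
pose H p := G (xget 0%N [set j | D j p.2]) p.
have HE j p : prism (D j) p -> H p = G j p.
  move=> [hs Dj]; rewrite /H; case: xgetP => [i _ /= Di|/(_ j)//].
  have [ij|ji] := leqP i j; first by rewrite (mono _ _ ij).2.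
  by rewrite (mono _ _ (ltnW ji)).2.
have inD x : W x -> exists j, D j x.
  by move=> /cover[j xj]; exists j; exact: nbhs_singleton.
exists H; split.
- apply/subspace_continuousP => p [hs Wp] U' HU'.
  have [j pj] := cover _ Wp; have Dp := nbhs_singleton pj.
  have [_ _ /subspace_continuousP cG _] := goodF j.
  have {}HU' : nbhs (G j p) U' by rewrite -HE.
  have := cG p (conj hs Dp) _ HU'.
  have pj2 : nbhs p [set q : R * V | D j q.2] by exact: (@cvg_snd _ _ (nbhs p.1) (nbhs p.2)) pj.
  rewrite /fmap /within /= => cGp; apply: filterS2 pj2 cGp => q Dq Gq [hq _].
  by rewrite /= /from_subspace (HE j) //; exact: Gq.
- move=> x Wx; have [j Dx] := inD x Wx.
  rewrite (HE j); last by split => //=; rewrite in_itv /= lexx ler01.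
  by have [_ _ _ /(_ _ Dx)[]] := goodF j.
- move=> x Wx; have [j Dx] := inD x Wx.
  rewrite (HE j); last by split => //=; rewrite in_itv /= lexx ler01.
  by have [_ _ _ /(_ _ Dx)[]] := goodF j.
Qed.

End Exhaustion.

(** * Contractibility *)

Lemma Re_continuous (R : realType) : continuous (fun z : Cplx R => complex.Re z : R).
Proof.
move=> z; have FF : Filter (nbhs z) by exact: nbhs_filter.
apply/(@cvgrPdist_lt _ _ _ (nbhs z) FF) => e e0.
have e0C : 0 < (e%:C%C : Cplx R) by rewrite ltcR.
exists (e%:C%C : Cplx R) => // w /=; rewrite normcE ltcR -ReB.
exact: le_lt_trans (Re_cabs _).
Qed.

Lemma Im_continuous (R : realType) : continuous (fun z : Cplx R => complex.Im z : R).
Proof.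
move=> z; have FF : Filter (nbhs z) by exact: nbhs_filter.
apply/(@cvgrPdist_lt _ _ _ (nbhs z) FF) => e e0.
have e0C : 0 < (e%:C%C : Cplx R) by rewrite ltcR.
exists (e%:C%C : Cplx R) => // w /=; rewrite normcE ltcR -ImB.
exact: le_lt_trans (Im_cabs _).
Qed.

Lemma fun_continuous_complex (R : realType) (T : topologicalType) (f g : T -> R) :
  continuous f -> continuous g ->
  continuous (fun x => (f x +i* g x)%C : Cplx R).
Proof.
move=> cf cg x.
have -> : (fun x => (f x +i* g x)%C : Cplx R) =
    (fun x => (f x)%:C%C + 'i%C * (g x)%:C%C : Cplx R).
  by apply/funext => y; rewrite [LHS]complexE.
apply: cvgD; last apply: cvgM.
- exact: (continuous_comp_fun cf (@real_complex_continuous R)).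
- exact: cvg_cst.
- exact: (continuous_comp_fun cg (@real_complex_continuous R)).
Qed.

Lemma contractible_from_fills (R : realType) n (U : set 'rV[Cplx R]_n) (u0 : U) :
  open U -> (forall k, fills (R := R) U k) -> contractible R U.
Proof.
move=> oU fillU.
(* [un] is the inverse of [re], so [W] is [U] in real coordinates. *)
pose re (z : 'rV[Cplx R]_n) := realify z.
pose un (x : 'rV[R]_(n + n)) : 'rV[Cplx R]_n :=
  \row_i (x 0 (lshift n i) +i* x 0 (rshift n i))%C.
have unK z : un (re z) = z.
  apply/rowP => i; rewrite !mxE !(unsplitK (inl i)) !(unsplitK (inr i)) !mxE.
  by case: (z 0 i).
have cun : continuous un.
  apply: continuous_rV => i.
  have -> : (fun x => un x 0 i) = (fun x : 'rV[R]_(n + n) =>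
      (x 0 (lshift n i) +i* x 0 (rshift n i))%C : Cplx R).
    by apply/funext => x; rewrite mxE.
  by apply: fun_continuous_complex => x; exact: coord_continuous.
have cre : continuous re.
  apply: continuous_rV => i.
  have cj j : continuous (fun z : 'rV[Cplx R]_n => z 0 j : Cplx R).
    by move=> z; exact: coord_continuous.
  case: (split_ordP i) => j ->.
    have -> : (fun z => re z 0 (lshift n j)) = (fun z => complex.Re (z 0 j : Cplx R)).
      by apply/funext => z; rewrite /re row_mxEl mxE.
    apply: (@continuous_comp_fun _ _ _ (fun z : 'rV[Cplx R]_n => z 0 j : Cplx R)
      (fun w : Cplx R => complex.Re w : R)); [exact: cj|exact: Re_continuous].
  have -> : (fun z => re z 0 (rshift n j)) = (fun z => complex.Im (z 0 j : Cplx R)).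
    by apply/funext => z; rewrite /re row_mxEr mxE.
  apply: (@continuous_comp_fun _ _ _ (fun z : 'rV[Cplx R]_n => z 0 j : Cplx R)
      (fun w : Cplx R => complex.Im w : R)); [exact: cj|exact: Im_continuous].
pose W : set 'rV[R]_(n + n) := un @^-1` U.
have oW : open W by apply: open_comp => // x _; exact: cun.
pose a x := into u0 (un x).
have ca : {within W, continuous a}.
  apply: (@within_comp _ _ _ W U un (into u0)); first exact: continuous_subspaceT.
    by [].
  exact: into_continuous.
have cb : {within W, continuous (fun=> u0)} by apply: continuous_subspaceT; exact: cst_continuous.
have [H [cH H0 H1]] := homotopy_from_open fillU oW ca cb.
exists u0, (H \o (fun p => (p.1, re (set_val p.2)))).
have WU (u : U) : W (re (set_val u)) by rewrite /W /= unK; exact: set_valP.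
split.
- apply: within_comp cH.
    apply: continuous_subspaceT; continuity.
    apply: (@continuous_comp_fun _ _ _ snd (fun u : U => re (set_val u))); first by continuity.
    by apply: continuous_comp_fun; [exact: val_continuous|exact: cre].
  by move=> [s u] [/= hs _]; split => //; exact: WU.
- by move=> u /=; rewrite H0 // /a unK into_val.
- by move=> u /=; rewrite H1.
Qed.

Theorem theorem11p2 (R : realType) (n : nat) (U : set 'rV[Cplx R]_n)
    (f : {fun U >-> U}) (hf : holomorphic_on U f) :
  open U -> connected U -> bounded_set U -> smooth_boundary (@realify R n @` U) ->
  (exists K : set 'rV[Cplx R]_n, [/\ compact K, K `<=` U & f @` U `<=` K]) ->
  (exists z : U, forall k : nat,
    group_isomorphism (pi_map R (holomorphic_continuous hf) z k.+1)) ->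
  contractible R U.
Proof.
move=> oU cU bU _ [K [cK KU fK]] [z iso].
have fUK x : U x -> K (f x) by move=> Ux; apply: fK; exists x.
have [N [p [r [r0 pU fN]]]] :=
  iterates_shrink oU cU bU cK KU fUK hf (set_valP z).
pose F : U -> U := sigLR f.
have FE m (u : U) : set_val (iter m F u) = iter m f (set_val u).
  by elim: m => //= m <-.
have pathU := subset_path_joined oU cU z.
have inj k : injective (pi_map R (holomorphic_continuous hf) z k.+1).
  by have [_ /bij_inj] := iso k.
apply: (contractible_from_fills z oU); apply: fills_of_null => // k g x gx.
have null_F := null_of_iter pathU inj; apply: (null_F k N g x gx).
have gN : pointed_map (iter N F \o g) (iter N F x).
  elim: N {fN} => [|N IH]; first exact: gx.
  exact: (pointed_map_comp (holomorphic_continuous hf) IH).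
apply: (small_image_null z gN pU) => t dt.
by rewrite FE; apply: fN; exact: set_valP.
Qed.
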